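(* Let $R$ be a Poisson process of intensity $1$ on $\mathbb{R}$, and consider $1$-colour matchings of $R$. (i) Let $\gamma\in[1,\infty]\cup\{1-,1+\}$ and let $M$ be the invariant $\gamma$-minimal matching scheme. The matching distance $X$ satisfies $$\mathbb{P}^*(X>x)=e^{-x},\qquad x>0.$$ (ii) Let $\gamma\in[-\infty,1)$ and let $M$ be any invariant $\gamma$-minimal matching scheme. We have $$\mathbb{P}^*(X>x)<c\,x^{-1},\qquad x>0,$$ for some $c=c(\gamma)>0$.
   Context: Point processes are identified with the random discrete sets of their points. Matchings. A $1$-colour matching of a set $R\subset\mathbb{R}$ is a set $M$ of unordered pairs $\langle x,y\rangle$ of distinct points of $R$, called edges, such that each point of $R$ belongs to at most one edge; $M(x)$ denotes the partner of a matched point $x$. A point in no edge is unmatched; $M^{-1}(\infty)$ denotes the set of unmatched points; $M$ is perfect if there are none. Matchings may have unmatched points. Cost functions. For $\gamma\in\mathbb{R}$ and $x>0$: $f_\gamma(x)=x^\gamma$ if $\gamma>0$, $f_0(x)=\log x$, and $f_\gamma(x)=-x^\gamma$ if $\gamma<0$. For a matching $M$ of a finite set, $f_\gamma[M]=\sum_{\langle x,y\rangle\in M}f_\gamma(|x-y|)$. Minimality for finite sets. Let $M$ be a $1$-colour matching of a finite set; below $m$ ranges over all $1$-colour matchings of the same set, and sequences are compared in lexicographic order $\preceq$. For $\gamma\in\mathbb{R}$, $M$ is $\gamma$-minimal if $(\#M^{-1}(\infty),f_\gamma[M])\preceq(\#m^{-1}(\infty),f_\gamma[m])$ for all $m$.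 Writing $|M|_\uparrow$ and $|M|_\downarrow$ for the increasing and decreasing orderings of the multiset of edge lengths of $M$ (shorter sequences are padded at the end with entries $-\infty$), $M$ is $(-\infty)$-minimal if $(\#M^{-1}(\infty),|M|_\uparrow)\preceq(\#m^{-1}(\infty),|m|_\uparrow)$ for all $m$, and $\infty$-minimal if the same holds with $|\cdot|_\downarrow$ in place of $|\cdot|_\uparrow$. Two edges in $\mathbb{R}$ with four distinct endpoints are entwined if exactly one endpoint of one lies between the endpoints of the other; one edge straddles another if both endpoints of the latter lie between the endpoints of the former. $M$ is $(1+)$-minimal if it is $1$-minimal and no two edges straddle, and $(1-)$-minimal if it is $1$-minimal and no two edges are entwined. Minimality for infinite sets. A subset $R'\subseteq R$ is compatible with $M$ if the partner of every matched point of $R'$ also belongs to $R'$. A matching $M$ of a countable set $R$ is $\gamma$-minimal if for every finite compatible $R'$ the restriction of $M$ (the set of edges of $M$ with endpoints in $R'$) is a $\gamma$-minimal matching of $R'$. Matching schemes. A matching scheme is a random matching $M$ of $R$ defined on a joint probability space with $R$; it is $\gamma$-minimal if it is a.s. a $\gamma$-minimal matching, and invariant if the joint law of $(R,M)$ is invariant under the diagonal action of every translation of $\mathbb{R}$. Invariant $\gamma$-minimal matching schemes of $R$ are a.s. perfect. For $\gamma\in[1,\infty]\cup\{1-,1+\}$ there are a.s. exactly two $\gamma$-minimal matchings of $R$, and there is exactly one invariant $\gamma$-minimal matching scheme (in law), namely the one which, conditionally on $R$, equals each of these two matchings with probability $\tfrac12$. Palm process and matching distance. For an invariant perfect matching scheme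 $M$, the Palm process $(R^*,M^* )$, with probability measure $\mathbb{P}^*$ and expectation $\mathbb{E}^*$, is characterized by $$\mathbb{E}\sum_{r\in R\cap[0,1)}h\bigl(\theta^{-r}(R,M)\bigr)=\mathbb{E}^*h(R^*,M^* )$$ for all non-negative measurable $h$, where $\theta^x$ denotes translation by $x$. The matching distance is $X:=|M^*(0)|$, where $M^*(0)$ is the partner of $0$ in $M^*$. *)

(* Defs.v *)
From mathcomp Require Import all_boot all_order all_algebra.
From mathcomp Require Import finmap.
From mathcomp Require Import all_classical all_reals all_analysis.
From mathcomp Require Import measurable_realfun.

Set Implicit Arguments.
Unset Strict Implicit.
Unset Printing Implicit Defensive.

Import Order.TTheory GRing.Theory Num.Theory.
Import numFieldNormedType.Exports.

Local Open Scope classical_set_scope.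
Local Open Scope ring_scope.

(* [K] is the real line.  An unordered pair <x, y> of distinct reals is encoded
   by the ordered pair [(min x y, max x y)], so a set of edges is a set of pairs
   [(a, b)] with [a < b], in which each edge occurs exactly once. *)

Definition endpoint (K : realType) (e : K * K) (x : K) : Prop :=
  x = e.1 \/ x = e.2.

Definition is_matching (K : realType) (R : set K) (M : set (K * K)) : Prop :=
  (forall e, M e -> [/\ R e.1, R e.2 & e.1 < e.2]) /\
  (forall e e' x, M e -> M e' -> endpoint e x -> endpoint e' x -> e = e').

Definition unmatched (K : realType) (R : set K) (M : set (K * K)) : set K :=
  [set x | R x /\ forall e, M e -> ~ endpoint e x].

Definition adjacent (K : realType) (M : set (K * K)) (x y : K) : Prop :=
  M (x, y) \/ M (y, x).

(* +oo when x is unmatched, as in the notation M^{-1}(oo). *)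
Definition partner (K : realType) (M : set (K * K)) (x : K) : \bar K :=
  xget +oo%E [set y%:E | y in [set y | adjacent M x y]].

(* [Extended a] is an exponent a in [-oo, +oo]; [OneMinus] and [OnePlus] are the
   formal parameters 1- and 1+. *)
Inductive parameter (K : realType) : Type :=
| Extended of \bar K
| OneMinus
| OnePlus.
Arguments OneMinus {K}.
Arguments OnePlus {K}.

Definition at_least_one (K : realType) (g : parameter K) : bool :=
  match g with
  | Extended a => (1%:E <= a)%E
  | OneMinus | OnePlus => true
  end.

Definition cost_fun (K : realType) (g x : K) : K :=
  if 0 < g then x `^ g else if g == 0 then ln x else - (x `^ g).

Definition cost (K : realType) (g : K) (M : set (K * K)) : K :=
  \sum_(e \in M) cost_fun g (e.2 - e.1).

Definition edge_lengths (K : realType) (M : set (K * K)) : seq K :=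
  [seq e.2 - e.1 | e <- enum_fset (fset_set M)].

Definition pad (K : realType) (s : seq K) : nat -> \bar K :=
  fun n => nth -oo%E [seq l%:E | l <- s] n.

Definition lengths_up (K : realType) (M : set (K * K)) : nat -> \bar K :=
  pad (sort (fun a b : K => a <= b) (edge_lengths M)).

Definition lengths_down (K : realType) (M : set (K * K)) : nat -> \bar K :=
  pad (sort (fun a b : K => b <= a) (edge_lengths M)).

Definition lex_seq (K : realType) (s t : nat -> \bar K) : Prop :=
  s = t \/
  exists n, (forall i, (i < n)%N -> s i = t i) /\ (s n < t n)%E.

Definition lex_pair (S : Type) (leS : S -> S -> Prop) (u v : nat * S) : Prop :=
  (u.1 < v.1)%N \/ (u.1 = v.1 /\ leS u.2 v.2).

Definition lex_minimal (K : realType) (S : Type) (leS : S -> S -> Prop)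
    (obj : set (K * K) -> S) (R : set K) (M : set (K * K)) : Prop :=
  let score m := (#|` fset_set (unmatched R m)|, obj m) in
  forall m, is_matching R m -> lex_pair leS (score M) (score m).

Definition between (K : realType) (e : K * K) (x : K) : bool := e.1 < x < e.2.

Definition four_endpoints (K : realType) (e e' : K * K) : bool :=
  uniq [:: e.1; e.2; e'.1; e'.2].

Definition entwined (K : realType) (e e' : K * K) : bool :=
  four_endpoints e e' && (between e e'.1 (+) between e e'.2).

Definition straddles (K : realType) (e e' : K * K) : bool :=
  four_endpoints e e' && (between e e'.1 && between e e'.2).

Definition real_minimal (K : realType) (g : K) :
    set K -> set (K * K) -> Prop :=
  lex_minimal (fun a b : K => a <= b) (cost g).

Definition finite_minimal (K : realType) (g : parameter K)
    (R : set K) (M : set (K * K)) : Prop :=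
  is_matching R M /\
  match g with
  | Extended (a%:E)%E => real_minimal a R M
  | Extended -oo%E => lex_minimal (@lex_seq K) (@lengths_up K) R M
  | Extended +oo%E => lex_minimal (@lex_seq K) (@lengths_down K) R M
  | OnePlus => real_minimal 1 R M /\
      forall e e', M e -> M e' -> ~~ straddles e e'
  | OneMinus => real_minimal 1 R M /\
      forall e e', M e -> M e' -> ~~ entwined e e'
  end.

Definition compatible (K : realType) (M : set (K * K)) (R' : set K) : Prop :=
  forall x y, R' x -> adjacent M x y -> R' y.

Definition restriction (K : realType) (M : set (K * K)) (R' : set K) :
    set (K * K) :=
  M `&` (R' `*` R').

Definition minimal (K : realType) (g : parameter K)
    (R : set K) (M : set (K * K)) : Prop :=
  is_matching R M /\
  forall R' : set K, R' `<=` R -> finite_set R' -> compatible M R' ->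
    finite_minimal g R' (restriction M R').

Definition locally_finite (K : realType) (R : set K) : Prop :=
  forall a b : K, finite_set (R `&` `[a, b]).

(* The sigma-algebra on pairs (point set, edge set) is generated by the events
   "A contains exactly n points" (A Borel in K) and "B contains exactly n
   edges" (B Borel in K * K). *)
Definition config_gen (K : realType) : set (set (set K * set (K * K))) :=
  [set E | exists2 A : set (measurableTypeR K), measurable A &
     exists n : nat, E = [set c | (c.1 `&` A #= `I_n)%card]] `|`
  [set E | exists2 B : set (measurableTypeR K * measurableTypeR K),
     measurable B & exists n : nat, E = [set c | (c.2 `&` B #= `I_n)%card]].

Definition config (K : realType) := g_sigma_algebraType (@config_gen K).

Definition translate (K : realType) (x : K) (c : config K) : config K :=
  ([set y + x | y in c.1], [set (e.1 + x, e.2 + x) | e in c.2]).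

Definition point_process (K : realType) (d : measure_display)
    (T : measurableType d) (R : T -> set K) : Prop :=
  (forall w, locally_finite (R w)) /\
  (forall (A : set (measurableTypeR K)) (n : nat), measurable A ->
     measurable [set w | (R w `&` A #= `I_n)%card]).

(* Intensity 1: joint Poisson counts on finitely many disjoint Borel sets of finite
   measure.  Null sets are covered, since 0 ^+ 0 = 1. *)
Definition poisson_process1 (K : realType) (d : measure_display)
    (T : measurableType d) (P : probability T K) (R : T -> set K) : Prop :=
  point_process R /\
  forall (n : nat) (A : 'I_n -> set (measurableTypeR K)) (k : 'I_n -> nat),
    (forall i, measurable (A i)) ->
    (forall i, (lebesgue_measure (A i) < +oo)%E) ->
    trivIset setT A ->
    P [set w | forall i, (R w `&` A i #= `I_(k i))%card] =
    (\prod_(i < n) (expR (- fine (lebesgue_measure (A i)))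
       * fine (lebesgue_measure (A i)) ^+ k i / (k i)`!%:R))%:E.

Definition pair_config (K : realType) (T : Type)
    (R : T -> set K) (M : T -> set (K * K)) : T -> config K :=
  fun w => (R w, M w).

Definition matching_scheme (K : realType) (d : measure_display)
    (T : measurableType d) (R : T -> set K) (M : T -> set (K * K)) : Prop :=
  (forall w, is_matching (R w) (M w)) /\
  measurable_fun [set: T] (pair_config R M).

Definition minimal_scheme (K : realType) (d : measure_display)
    (T : measurableType d) (P : probability T K) (g : parameter K)
    (R : T -> set K) (M : T -> set (K * K)) : Prop :=
  \forall w \ae P, minimal g (R w) (M w).

Definition invariant_scheme (K : realType) (d : measure_display)
    (T : measurableType d) (P : probability T K)
    (R : T -> set K) (M : T -> set (K * K)) : Prop :=
  forall (x : K) (B : set (config K)), measurable B ->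
    P ((translate x \o pair_config R M) @^-1` B) = P (pair_config R M @^-1` B).

Definition invariant_minimal_scheme (K : realType) (d : measure_display)
    (T : measurableType d) (P : probability T K) (g : parameter K)
    (R : T -> set K) (M : T -> set (K * K)) : Prop :=
  [/\ matching_scheme R M, invariant_scheme P R M & minimal_scheme P g R M].

(* [(R', M')] under [P'] is the Palm version of [(R, M)].  It is a locally
   finite set with a matching of it at every outcome, which makes the matching
   distance below measurable. *)
Definition palm_process (K : realType)
    (d : measure_display) (T : measurableType d) (P : probability T K)
    (R : T -> set K) (M : T -> set (K * K))
    (d' : measure_display) (T' : measurableType d') (P' : probability T' K)
    (R' : T' -> set K) (M' : T' -> set (K * K)) : Prop :=
  [/\ point_process R', matching_scheme R' M' &
   forall h : config K -> \bar K, measurable_fun [set: config K] h ->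
     (forall c, (0 <= h c)%E) ->
     (\int[P]_w (\esum_(r in R w `&` `[0%R, 1%R[)
         h (translate (- r) (pair_config R M w))) =
      \int[P']_w h (pair_config R' M' w))%E].

Definition matching_distance (K : realType) (T' : Type)
    (M' : T' -> set (K * K)) (w : T') : \bar K :=
  `|partner (M' w) 0|%E.

(* Main.v *)
Require Import Defs.
From mathcomp Require Import all_boot all_order all_algebra.
From mathcomp Require Import finmap.
From mathcomp Require Import all_classical all_reals all_analysis.
From mathcomp Require Import measurable_realfun.
From mathcomp Require Import ring lra.

(* Let mu D be the expected number of edges, written (a, b) with a < b, in a
   Borel set D of pairs; it is invariant under diagonal translations.  The Palm
   formula gives P*(X in J) = mu(0 <= a < 1, b - a in J) + mu(0 <= b < 1, b - a in J),
   and since two unmatched points could be matched together, a minimal matching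
   has at most one of them, so by stationarity the scheme is a.s. perfect.

   For gamma < 1: if two edges longer than x had left ends at distance < x and
   right ends at distance < x, joining left with left and right with right would
   be strictly better.  So a window of length <= x contains at most 2 left ends,
   and at most 2 right ends, of edges with length in (x, 2x].  This gives
   P*(X > x) <= 8/x + P*(X > 2x), which is summed over dyadic scales.

   For gamma >= 1: edges join consecutive points, so R determines the matching
   up to a sign; the sign at t is (-1)^N times the sign at s, N being the number
   of points in [s, t).  As E (-1)^N decays exponentially, a second moment bound
   shows that the sign is uncorrelated with the event that R has no point in
   [0, x).  Hence an edge covers [0, x) with probability e^{-x}/2, and the law
   of X is recovered by differentiating this in x. *)

Set Implicit Arguments.
Unset Strict Implicit.
Unset Printing Implicit Defensive.

Import Order.TTheory GRing.Theory Num.Theory.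
Import numFieldNormedType.Exports.

Local Open Scope classical_set_scope.
Local Open Scope ring_scope.

(** * Counting points and edges *)

(** Takes the value [+oo] on every infinite set. Being an [esum], it inherits splitting, reindexing
    and fibring. *)
Definition ecard (K : realType) (U : choiceType) (A : set U) : \bar K :=
  \esum_(_ in A) 1%E.
Arguments ecard {K U} A.

Section Ecard.
Context {K : realType}.
Local Open Scope ereal_scope.
Local Notation ecard := (@ecard K _).

Lemma ecard_ge0 (U : choiceType) (A : set U) : 0 <= ecard A.
Proof. by apply: esum_ge0 => *; exact: lee01. Qed.

Lemma le_ecard (U : choiceType) (A B : set U) : A `<=` B -> ecard A <= ecard B.
Proof.
move=> AB; rewrite /ecard esum_mkcond [leRHS]esum_mkcond; apply: le_esum => x _.
case: ifPn => [/set_mem/AB/mem_set ->//|_]; by case: ifPn.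
Qed.

Lemma ecardID (U : choiceType) (B A : set U) :
  ecard A = ecard (A `&` B) + ecard (A `&` ~` B).
Proof. by rewrite /ecard (esumID B). Qed.

Lemma ecardU (U : choiceType) (A B : set U) : [disjoint A & B]%classic ->
  ecard (A `|` B) = ecard A + ecard B.
Proof.
move=> /disj_set2P AB; rewrite (ecardID A) setUK; congr (_ + ecard _).
by rewrite setIUl setICr set0U; apply/setIidPl => x Bx Ax; rewrite -[False]/(set0 x) -AB.
Qed.

Lemma ecard_fset (U : choiceType) (A : set U) : finite_set A ->
  ecard A = (#|` fset_set A|)%:R%:E.
Proof.
move=> fA; rewrite /ecard esum_fset// fsbig_finite//=.
by rewrite sumEFin big_const_seq count_predT iter_addr addr0.
Qed.

Lemma ecard_infinite (U : choiceType) (A : set U) : infinite_set A -> ecard A = +oo.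
Proof.
move=> iA; apply/eqyP => r r0.
have [B BA nB] := infinite_set_fset (Num.truncn r).+1 iA.
rewrite (@le_trans _ _ (ecard [set` B]))//; last exact: le_ecard.
rewrite ecard_fset// set_fsetK lee_fin (le_trans (ltW (truncnS_gt r)))//.
by rewrite ler_nat.
Qed.

(** Links this count to the cardinality events that generate the sigma-algebra of [config]. *)
Lemma ecard_eqn (U : choiceType) (A : set U) (n : nat) :
  ecard A = n%:R%:E <-> (A #= `I_n)%card.
Proof.
split=> [|An].
  have [fA|/ecard_infinite ->//] := pselect (finite_set A).
  rewrite ecard_fset// => -[/eqP]; rewrite eqr_nat => /eqP <-.
  by rewrite -[X in (X #= _)%card](fset_setK fA); apply/card_eq_fsetP.
by rewrite ecard_fset ?(card_fset_set An)//; apply/finite_setP; exists n.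
Qed.

Lemma ecard0 (U : choiceType) : ecard (@set0 U) = 0.
Proof. exact: esum_set0. Qed.

Lemma ecard1 (U : choiceType) (x : U) : ecard [set x] = 1.
Proof. by rewrite /ecard esum_set1. Qed.

Lemma ecard_le1 (U : choiceType) (A : set U) :
  (forall x y, A x -> A y -> x = y) -> ecard A <= 1.
Proof.
move=> A1; have [->|/set0P[x Ax]] := eqVneq A set0; first by rewrite ecard0.
by rewrite -(ecard1 x); apply: le_ecard => y /A1; exact.
Qed.

Lemma ecard_image (U V : choiceType) (f : U -> V) (A : set U) :
  set_inj A f -> ecard (f @` A) = ecard A.
Proof. by move=> fA; rewrite /ecard esum_image. Qed.

Lemma ecard_finite (U : choiceType) (A : set U) :
  finite_set A -> ecard A \is a fin_num.
Proof. by move=> fA; rewrite ecard_fset. Qed.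

(** Countably many events, one for each finite count, determine the function; it equals [+oo]
    exactly off their union. *)
Lemma measurable_ecard d (T : measurableType d) (U : choiceType) (F : T -> set U) :
  (forall n, measurable [set w | F w #= `I_n]%card) ->
  measurable_fun [set: T] (fun w => ecard (F w)).
Proof.
move=> mF _ Y mY; rewrite setTI.
pose E n := [set w | (F w #= `I_n)%card].
rewrite (_ : _ @^-1` _ =
    \bigcup_(n in [set n | Y n%:R%:E]) E n `|`
    if `[<Y +oo>] then ~` \bigcup_n E n else set0).
  apply: measurableU; first by apply: bigcup_measurable => n _; exact: mF.
  by case: ifP => // _; apply: measurableC; apply: bigcup_measurable => n _; exact: mF.
have cardE w : (exists2 n, E n w & ecard (F w) = n%:R%:E) \/
    ecard (F w) = +oo /\ ~ (\bigcup_n E n) w.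
  have [/finite_setP[n Fn]|iF] := pselect (finite_set (F w)).
    by left; exists n => //; apply/ecard_eqn.
  right; split; [exact: ecard_infinite|move=> [n _ En]].
  by apply: iF; apply/finite_setP; exists n.
apply/seteqP; split => w /=.
  case: (cardE w) => [[n En ->] Yn|[-> nE] Yy]; first by left; exists n.
  by right; rewrite asboolT.
move=> [[n /= Yn /ecard_eqn ->]//|]; case: ifPn => // /asboolP Yy nE.
by case: (cardE w) => [[n En _]|[->]]//; exfalso; apply: nE; exists n.
Qed.

End Ecard.

(** * Counting functions of a configuration *)

Section Counts.
Context {K : realType}.
Implicit Types (c : config K).
Local Notation KK := (measurableTypeR K * measurableTypeR K)%type.

Definition edges_in (D : set (K * K)) (c : config K) : \bar K := ecard (c.2 `&` D).
Definition points_in (A : set K) (c : config K) : \bar K := ecard (c.1 `&` A).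

Lemma measurable_edges_in (D : set KK) : measurable D ->
  measurable_fun [set: config K] (edges_in D).
Proof.
move=> mD; apply: measurable_ecard => n; apply: sub_sigma_algebra.
by right; exists D => //; exists n.
Qed.

Lemma measurable_points_in (A : set (measurableTypeR K)) : measurable A ->
  measurable_fun [set: config K] (points_in A).
Proof.
move=> mA; apply: measurable_ecard => n; apply: sub_sigma_algebra.
by left; exists A => //; exists n.
Qed.

Lemma edges_in_translate (D : set (K * K)) (t : K) c :
  edges_in D (translate t c) = edges_in [set e | D (e.1 + t, e.2 + t)] c.
Proof.
rewrite /edges_in -[RHS](@ecard_image _ _ _ (fun e : K * K => (e.1 + t, e.2 + t))).
  congr ecard; apply/seteqP; split => x /=.
    by move=> [[e ce xe] De]; exists e => //; split => //; rewrite /= xe.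
  by move=> [e [ce De] <-]; split => //; exists e.
by move=> [a b] [a' b'] _ _ /= [/addIr -> /addIr ->].
Qed.

Lemma points_in_translate (A : set K) (t : K) c :
  points_in A (translate t c) = points_in [set x | A (x + t)] c.
Proof.
rewrite /points_in -[RHS](@ecard_image _ _ _ (fun x => x + t)).
  congr ecard; apply/seteqP; split => x /=.
    by move=> [[e ce xe] De]; exists e => //; split => //; rewrite /= xe.
  by move=> [e [ce De] <-]; split => //; exists e.
by move=> a a' _ _ /= /addIr.
Qed.

Lemma edges_inID (B D : set (K * K)) c :
  edges_in D c = (edges_in (D `&` B) c + edges_in (D `&` ~` B) c)%E.
Proof. by rewrite /edges_in (ecardID B) -!setIA. Qed.

Lemma le_edges_in (D D' : set (K * K)) c : D `<=` D' -> (edges_in D c <= edges_in D' c)%E.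
Proof. by move=> DD'; apply: le_ecard; exact: setIS. Qed.

Lemma edges_in_ge0 (D : set (K * K)) c : (0 <= edges_in D c)%E.
Proof. exact: ecard_ge0. Qed.

Lemma points_in_ge0 (A : set K) c : (0 <= points_in A c)%E.
Proof. exact: ecard_ge0. Qed.

End Counts.

(** * Exchange arguments *)

Section Exchange.
Context {K : realType}.
Implicit Types (R : set K) (M : set (K * K)) (e f : K * K) (g : parameter K).

Definition elen e : K := e.2 - e.1.
Definition ends e f : seq K := [:: e.1; e.2; f.1; f.2].

Lemma perm_enum_pair e f : e != f ->
  perm_eq (enum_fset (fset_set [set e; f])) [:: e; f].
Proof.
move=> ef; apply: uniq_perm; first exact: fset_uniq.
  by rewrite /= inE ef.
have fin : finite_set [set e; f] by exact: finite_set2.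
move=> x; rewrite (in_fset_set fin) !inE; apply/idP/idP.
  by rewrite inE => -[->|->]; rewrite eqxx ?orbT.
by move=> /orP[/eqP ->|/eqP ->]; rewrite inE; [left|right].
Qed.

Lemma cost_pair (a : K) e f : e != f ->
  cost a [set e; f] = cost_fun a (elen e) + cost_fun a (elen f).
Proof.
move=> ef; rewrite /cost fsbig_finite//=.
by rewrite (perm_big _ (perm_enum_pair ef)) big_cons big_seq1.
Qed.

Lemma perm_edge_lengths_pair e f : e != f ->
  perm_eq (edge_lengths [set e; f]) [:: elen e; elen f].
Proof. by move=> ef; exact: (perm_map _ (perm_enum_pair ef)). Qed.

Lemma lengths_up_pair e f : e != f ->
  lengths_up [set e; f] 0 = (Num.min (elen e) (elen f))%:E.
Proof.
move=> ef; rewrite /lengths_up.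
rewrite (_ : sort _ _ = sort (fun a b : K => a <= b) [:: elen e; elen f]); last first.
  apply/perm_sortP; [exact: le_total|exact: le_trans|exact: le_anti|].
  exact: perm_edge_lengths_pair.
by rewrite /pad /sort /=; case: leP.
Qed.

Lemma lengths_down_pair e f : e != f ->
  lengths_down [set e; f] 0 = (Num.max (elen e) (elen f))%:E.
Proof.
move=> ef; rewrite /lengths_down.
rewrite (_ : sort _ _ = sort (fun a b : K => b <= a) [:: elen e; elen f]); last first.
  apply/perm_sortP.
  - by move=> a b; exact: le_total.
  - by move=> a b c ab bc; exact: le_trans bc ab.
  - by move=> a b /andP[ab ba]; apply/le_anti/andP.
  exact: perm_edge_lengths_pair.
by rewrite /pad /sort /=; case: leP.
Qed.

Lemma lex_seq_le0 (s t : nat -> \bar K) : lex_seq s t -> (s 0%N <= t 0%N)%E.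
Proof.
move=> [->//|[[|n] [st]]]; first exact: ltW.
by move=> _; rewrite st ?lexx.
Qed.

(** What optimality of two edges implies against a rematching of their endpoints, in terms of
    lengths alone. For [-oo] and [+oo] only the first entries of the sorted sequences are compared,
    which suffices for the contradictions below. *)
Definition no_worse g (l1 l2 l1' l2' : K) : Prop :=
  match g with
  | Extended (a%:E)%E =>
      cost_fun a l1 + cost_fun a l2 <= cost_fun a l1' + cost_fun a l2'
  | Extended -oo%E => Num.min l1 l2 <= Num.min l1' l2'
  | Extended +oo%E => Num.max l1 l2 <= Num.max l1' l2'
  | OnePlus | OneMinus =>
      cost_fun 1 l1 + cost_fun 1 l2 <= cost_fun 1 l1' + cost_fun 1 l2'
  end.

Lemma pair_matching e f : e.1 < e.2 -> f.1 < f.2 -> uniq (ends e f) ->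
  is_matching [set` ends e f] [set e; f] /\
  unmatched [set` ends e f] [set e; f] = set0.
Proof.
case: e f => a b [c d] /= ab cd; rewrite /ends /= !inE !negb_or.
move=> /andP[/and3P[nab nac nad] /andP[/andP[nbc nbd] /andP[ncd _]]].
split; first split.
- by move=> e [->|->] /=; split => //=; rewrite !inE !eqxx ?orbT.
- move=> e e' x [->|->] [->|->] [->|->] [/=|/=] => //; move/eqP;
  by rewrite ?(negbTE nac) ?(negbTE nad) ?(negbTE nbc) ?(negbTE nbd)
     1?eq_sym ?(negbTE nac) ?(negbTE nad) ?(negbTE nbc) ?(negbTE nbd).
- apply/seteqP; split => // x [/=]; rewrite !inE.
  move=> /or4P[] /eqP -> u.
  + by apply: (u (a, b)); [left|left].
  + by apply: (u (a, b)); [left|right].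
  + by apply: (u (c, d)); [right|left].
  + by apply: (u (c, d)); [right|right].
Qed.

Lemma matching_uniq_ends R M e f : is_matching R M -> M e -> M f -> e != f ->
  uniq (ends e f).
Proof.
move=> [M1 M2] Me Mf ef.
have [_ _ e12] := M1 _ Me; have [_ _ f12] := M1 _ Mf.
have H x : endpoint e x -> endpoint f x -> False.
  by move=> ex fx; move/eqP: ef; apply; exact: (M2 _ _ x).
rewrite /ends /= !inE !negb_or (lt_eqF e12) (lt_eqF f12) !andbT /=.
apply/andP; split; apply/andP; split; apply/eqP => E.
- by apply: (H e.1); [left|rewrite E; left].
- by apply: (H e.1); [left|rewrite E; right].
- by apply: (H e.2); [right|rewrite E; left].
- by apply: (H e.2); [right|rewrite E; right].
Qed.

(** The four endpoints form a finite set compatible with [M], and no other edge of [M] meets it. *)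
Lemma minimal_pair R M e f g : minimal g R M -> M e -> M f -> e != f ->
  finite_minimal g [set` ends e f] [set e; f].
Proof.
move=> [[M1 M2] mM] Me Mf ef.
have endsP x : [set` ends e f] x -> endpoint e x \/ endpoint f x.
  by rewrite /= !inE => /or4P[] /eqP ->; [left; left|left; right|right; left|right; right].
have endsP' x : endpoint e x \/ endpoint f x -> [set` ends e f] x.
  by rewrite /= !inE => -[[]|[]] ->; rewrite eqxx ?orbT.
have MP e' x : M e' -> endpoint e' x -> [set` ends e f] x -> e' = e \/ e' = f.
  move=> Me' ex /endsP[ex'|fx]; [left|right]; exact: (M2 _ _ x).
suff <- : restriction M [set` ends e f] = [set e; f].
  apply: mM => //.
  - move=> x /endsP[[]|[]] ->.
    + by have [] := M1 _ Me.
    + by have [] := M1 _ Me.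
    + by have [] := M1 _ Mf.
    + by have [] := M1 _ Mf.
  - move=> x y Rx [Mxy|Mxy]; apply: endsP'.
    + by have [||<-|<-] := MP _ x Mxy => //; [left|left; right|right; right].
    + by have [||<-|<-] := MP _ x Mxy => //; [right|left; left|right; left].
apply/seteqP; split => e' /=.
  by move=> [Me' [Re _]]; have [||->|->] := MP _ e'.1 Me' => //; [left|left|right].
move=> [->|->]; split => //; split; apply: endsP'.
- by left; left.
- by left; right.
- by right; left.
- by right; right.
Qed.

(** Both pairs of edges match the same four points perfectly, so the numbers of unmatched points tie
    and the costs decide. *)
Lemma exchange R M e f e' f' g : minimal g R M -> M e -> M f -> e != f ->
  e'.1 < e'.2 -> f'.1 < f'.2 -> perm_eq (ends e' f') (ends e f) ->
  no_worse g (elen e) (elen f) (elen e') (elen f').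
Proof.
move=> mM Me Mf ef e'12 f'12 pm.
have u := matching_uniq_ends mM.1 Me Mf ef.
have u' : uniq (ends e' f') by rewrite (perm_uniq pm).
have ef' : e' != f' by apply: contraTneq u' => ->; rewrite /= !inE eqxx orbT.
have Rm : [set` ends e f] = [set` ends e' f'].
  by apply/seteqP; split => x; rewrite /= (perm_mem pm).
have [m' um'] := pair_matching e'12 f'12 u'.
have [[_ _ e12] [_ _ f12]] := (mM.1.1 _ Me, mM.1.1 _ Mf).
have [_ um] := pair_matching e12 f12 u.
have key S (leS : S -> S -> Prop) (obj : set (K * K) -> S) :
    lex_minimal leS obj [set` ends e f] [set e; f] ->
    leS (obj [set e; f]) (obj [set e'; f']).
  rewrite Rm => /(_ _ m'); rewrite /= um' -Rm um.
  by move=> [|[]//]; rewrite ltnn.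
have := (minimal_pair mM Me Mf ef).2.
case: g {mM} => [[a| |]| |] /=.
- by move=> /key; rewrite !cost_pair.
- by move=> /key /lex_seq_le0; rewrite !lengths_down_pair.
- by move=> /key /lex_seq_le0; rewrite !lengths_up_pair.
- by move=> [/key + _]; rewrite !cost_pair.
- by move=> [/key + _]; rewrite !cost_pair.
Qed.

(** Neither point lies on an edge, so the two points form a compatible set to which [M] restricts as
    the empty matching; the edge joining them leaves fewer points unmatched. *)
Lemma minimal_unmatched_unique R M g x y : minimal g R M ->
  unmatched R M x -> unmatched R M y -> x = y.
Proof.
wlog xy : x y / x < y.
  move=> H mM ux uy; have [xy|xy|//] := ltgtP x y; first exact: H.
  by apply/esym; exact: H.
move=> [[M1 M2] mM] [Rx ux] [Ry uy]; exfalso.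
have rE : restriction M [set x; y] = set0.
  apply/seteqP; split => // e [Me [ex _]].
  by case: ex => ex; [apply: (ux _ Me)|apply: (uy _ Me)]; left.
have : finite_minimal g [set x; y] (restriction M [set x; y]).
  apply: mM.
  - by move=> _ [->|->].
  - exact: finite_set2.
  - move=> u v [->|->] [m|m].
    + by exfalso; apply: (ux _ m); left.
    + by exfalso; apply: (ux _ m); right.
    + by exfalso; apply: (uy _ m); left.
    + by exfalso; apply: (uy _ m); right.
rewrite rE => -[_].
have m' : is_matching [set x; y] [set (x, y)].
  split; first by move=> _ ->; split => //=; [left|right].
  by move=> e e' z -> ->.
have um' : unmatched [set x; y] [set (x, y)] = set0.
  apply/seteqP; split => // z [[->|->] /(_ (x, y) erefl)]; apply.
    by left.
  by right.
have um : unmatched [set x; y] (@set0 (K * K)) = [set x; y].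
  by apply/seteqP; split => z // [].
have cum : (#|` fset_set (unmatched [set x; y] (@set0 (K * K)))| <= 0)%N -> False.
  rewrite um leqn0 => /eqP /cardfs0_eq xy0.
  have : x \in fset_set [set x; y] by rewrite in_fset_set ?finite_set2// inE; left.
  by rewrite xy0 inE.
have key S (leS : S -> S -> Prop) (obj : set (K * K) -> S) :
    lex_minimal leS obj [set x; y] set0 -> False.
  move=> /(_ _ m'); rewrite /= um' fset_set0 cardfs0.
  by move=> [|[/= c0 _]]//=; apply: cum; rewrite c0.
case: g {mM} => [[a| |]| |] /=; try exact: key; by move=> [/key].
Qed.

(** For [a < 0] the power is decreasing, and the minus sign in [cost_fun] restores monotonicity. *)
Lemma lt_cost_fun (a x y : K) : 0 < x -> x < y -> cost_fun a x < cost_fun a y.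
Proof.
move=> x0 xy; rewrite /cost_fun; have y0 := lt_trans x0 xy.
case: (ltgtP 0 a) => [a0|a0|a0].
- by rewrite gt0_ltr_powR// ?nnegrE ltW.
- rewrite ltrN2 -[a]opprK !(powRN _ (- a)) ltf_pV2 ?posrE ?powR_gt0//.
  by rewrite gt0_ltr_powR// ?nnegrE ?oppr_gt0// ltW.
- by rewrite ltr_ln.
Qed.

(** Write [x^a] as [x] times [x^(a-1)]; for [a >= 1] both [x^(a-1)] and [y^(a-1)] are at most
    [(x+y)^(a-1)]. *)
Lemma cost_fun_superadditive (a x y : K) : 1 <= a -> 0 < x -> 0 < y ->
  cost_fun a x + cost_fun a y <= cost_fun a (x + y).
Proof.
move=> a1 x0 y0; have a0 := lt_le_trans ltr01 a1; rewrite /cost_fun a0.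
rewrite -(mulr_powRB1 (ltW x0) a0) -(mulr_powRB1 (ltW y0) a0).
rewrite -(mulr_powRB1 (addr_ge0 (ltW x0) (ltW y0)) a0) mulrDl.
have b0 : 0 <= a - 1 by rewrite subr_ge0.
apply: lerD; rewrite ler_pM2l//; apply: ge0_ler_powR; rewrite ?nnegrE//; lra.
Qed.

Lemma no_worse_lt g (l1 l2 l1' l2' : K) : 0 < l1' -> 0 < l2' ->
  l1' < l1 -> l2' < l2 -> ~ no_worse g l1 l2 l1' l2'.
Proof.
move=> p1 p2 lt1 lt2.
have lt12 a := ltrD (lt_cost_fun a p1 lt1) (lt_cost_fun a p2 lt2).
case: g => [[a| |]| |] /=; apply/negP; rewrite -ltNge ?lt12//.
- by rewrite gt_max !lt_max lt1 lt2 orbT.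
- by rewrite lt_min !gt_min lt1 lt2 orbT.
Qed.

(** Meant for an edge of length [l2] nested in one of length [l1], with gaps [l1'] and [l2'] on its
    sides. By superadditivity the gaps cost at most the outer edge, and the inner edge is saved; for
    [+oo], each gap is shorter than the outer edge. *)
Lemma no_worse_nested g (l1 l2 l1' l2' : K) : at_least_one g ->
  0 < l1' -> 0 < l2' -> 0 < l2 -> l1' + l2' <= l1 -> ~ no_worse g l1 l2 l1' l2'.
Proof.
move=> g1 p1 p2 p2' le1.
have cost_lt a : 1 <= a ->
    cost_fun a l1' + cost_fun a l2' < cost_fun a l1 + cost_fun a l2.
  move=> a1; apply: (le_lt_trans (cost_fun_superadditive a1 p1 p2)).
  have a0 := lt_le_trans ltr01 a1.
  have p12 : 0 <= l1' + l2' by rewrite addr_ge0 ?(ltW p1) ?(ltW p2).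
  rewrite (@le_lt_trans _ _ (cost_fun a l1))//.
    by rewrite /cost_fun a0 ge0_ler_powR ?(ltW a0) ?nnegrE// (le_trans p12).
  by rewrite ltrDl /cost_fun a0 powR_gt0.
have maxlt : Num.max l1' l2' < Num.max l1 l2.
  by rewrite gt_max !lt_max; apply/andP; split; apply/orP; left; lra.
case: g g1 => [[a| |]| |] //= g1; apply/negP; rewrite -ltNge ?cost_lt//.
Qed.

(* Matching the four points consecutively is strictly better than letting an
   edge straddle another one or be entwined with it. *)
Lemma no_point_between R M g e x : at_least_one g -> minimal g R M ->
  unmatched R M = set0 -> M e -> R x -> e.1 < x < e.2 -> False.
Proof.
move=> g1 mM u0 Me Rx /andP[e1x xe2].
have [f [Mf fx]] : exists f, M f /\ endpoint f x.
  apply: contrapT => nf; suff : unmatched R M x by rewrite u0.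
  by split => // f Mf fx; apply: nf; exists f.
have ef : e != f.
  apply/eqP => E; move: fx; rewrite -E => -[] xE.
    by rewrite xE ltxx in e1x.
  by rewrite xE ltxx in xe2.
have [_ _ f12] := mM.1.1 _ Mf.
have := matching_uniq_ends mM.1 Me Mf ef; rewrite /ends /= !inE !negb_or.
move=> /andP[/and3P[_ n1 n2] /andP[/andP[n3 n4] _]].
have ex e' f' := @exchange _ _ _ _ e' f' _ mM Me Mf ef.
(* Permutations of explicit four-element lists are checked by comparing how many entries satisfy
   each predicate. *)
have pp (a b c d a' b' c' d' : K) :
    (forall p : pred K, p a + (p b + (p c + (p d + 0))) =
      p a' + (p b' + (p c' + (p d' + 0))))%N ->
    perm_eq [:: a; b; c; d] [:: a'; b'; c'; d'].
  by move=> H; apply/permP => p; exact: H.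
(* With [e = (a, b)] and [f = (c, d)], the point [x] is [c] or [d]. Each time [f] is either nested
   in [e] or entwined with it, and the competitor joins the first two and the last two of the four
   points. *)
move: e f {u0 Me Mf ef mM} fx e1x xe2 f12 n1 n2 n3 n4 ex => [a b] [c d] /=.
move=> [/= ->|/= ->] ax xb cd n1 n2 n3 n4 ex.
- have [db|bd] := ltP d b.
    apply: (@no_worse_nested g (b - a) (d - c) (c - a) (b - d)) => //; try lra.
    have := ex (a, c) (d, b); rewrite /elen /=; apply => //; apply: pp => p.
    by case: (p a); case: (p b); case: (p c); case: (p d).
  have {}bd : b < d by rewrite lt_neqAle n4.
  apply: (@no_worse_lt g (b - a) (d - c) (c - a) (d - b)) => //; try lra.
  have := ex (a, c) (b, d); rewrite /elen /=; apply => //; apply: pp => p.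
  by case: (p a); case: (p b); case: (p c); case: (p d).
- have [ac|ca] := ltP a c.
    apply: (@no_worse_nested g (b - a) (d - c) (c - a) (b - d)) => //; try lra.
    have := ex (a, c) (d, b); rewrite /elen /=; apply => //; apply: pp => p.
    by case: (p a); case: (p b); case: (p c); case: (p d).
  have {}ca : c < a by rewrite lt_neqAle eq_sym n1.
  apply: (@no_worse_lt g (b - a) (d - c) (b - d) (a - c)) => //; try lra.
  have := ex (d, b) (c, a); rewrite /elen /=; apply => //; apply: pp => p.
  by case: (p a); case: (p b); case: (p c); case: (p d).
Qed.

(** Join left end with left end and right end with right end: the new lengths are below [x], hence
    below the old ones, and they are positive because the endpoints are distinct. *)
Lemma no_close_long_edges R M g e f (x : K) : minimal g R M -> M e -> M f ->
  x < elen e -> x < elen f -> `|e.1 - f.1| < x -> `|e.2 - f.2| < x -> e = f.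
Proof.
move=> mM Me Mf le lf d1 d2; apply/eqP/negP => /negP ef.
have u := matching_uniq_ends mM.1 Me Mf ef.
pose e' := (Num.min e.1 f.1, Num.max e.1 f.1).
pose f' := (Num.min e.2 f.2, Num.max e.2 f.2).
have pm : perm_eq (ends e' f') (ends e f).
  rewrite /e' /f'; apply/permP => p; rewrite /ends /=.
  by case: (ltP e.1 f.1); case: (ltP e.2 f.2) => _ _;
    case: (p e.1); case: (p e.2); case: (p f.1); case: (p f.2).
move: u; rewrite /ends /= !inE !negb_or => /andP[/and3P[_ n1 _] /andP[/andP[_ n2] _]].
have e'12 : e'.1 < e'.2.
  by rewrite /e' /= gt_min !lt_max !ltxx /= orbF -neq_lt.
have f'12 : f'.1 < f'.2.
  by rewrite /f' /= gt_min !lt_max !ltxx /= orbF -neq_lt.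
have le' : elen e' < x.
  by move: d1; rewrite /elen /e' /=; case: (ltP e.1 f.1) => h;
    [rewrite ltr0_norm|rewrite ger0_norm]; lra.
have lf' : elen f' < x.
  by move: d2; rewrite /elen /f' /=; case: (ltP e.2 f.2) => h;
    [rewrite ltr0_norm|rewrite ger0_norm]; lra.
apply: no_worse_lt (exchange mM Me Mf ef e'12 f'12 pm).
- by rewrite /elen subr_gt0.
- by rewrite /elen subr_gt0.
- exact: lt_trans le' le.
- exact: lt_trans lf' lf.
Qed.
End Exchange.

(** * Intensities and the Palm formula *)

(** For equalities of sets cut out by linear inequalities: conjunctions are unpacked, negated
    comparisons reversed, and linear arithmetic concludes. *)
Ltac set_interval_lra :=
  repeat match goal with
  | H : _ /\ _ |- _ => destruct H
  | H : is_true (_ && _) |- _ => move/andP : H => H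
  | H : ~ is_true (_ < _) |- _ => move/negP : H; rewrite -leNgt => H
  | H : ~ is_true (_ <= _) |- _ => move/negP : H; rewrite -ltNge => H
  | |- _ /\ _ => split
  | |- is_true (_ && _) => apply/andP
  | |- ~ is_true (_ < _) => apply/negP; rewrite -leNgt
  | |- ~ is_true (_ <= _) => apply/negP; rewrite -ltNge
  end; try done; try lra.

(** * Sets of edges cut out by the position of an end and by the length *)

Section Strips.
Context {K : realType}.
Local Notation rT := (measurableTypeR K).
Local Notation KK := (rT * rT)%type.
Implicit Types (J : set rT) (s t : K).

(** The window is half-open so that adjacent windows tile the line; a diagonal translation moves the
    window and keeps [J]. *)
Definition left_in s t J : set KK := [set e | s <= e.1 < t /\ J (e.2 - e.1)].
Definition right_in s t J : set KK := [set e | s <= e.2 < t /\ J (e.2 - e.1)].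
Definition edges_at s J : set KK := [set e | (e.1 = s \/ e.2 = s) /\ J (e.2 - e.1)].

Lemma measurable_preimage_fst (A : set rT) : measurable A ->
  measurable [set e : KK | A e.1].
Proof.
by move=> mA; rewrite -[X in measurable X]setTI; exact: (@measurable_fst _ _ rT rT).
Qed.

Lemma measurable_preimage_snd (A : set rT) : measurable A ->
  measurable [set e : KK | A e.2].
Proof.
by move=> mA; rewrite -[X in measurable X]setTI; exact: (@measurable_snd _ _ rT rT).
Qed.

Lemma measurable_preimage_sub J : measurable J ->
  measurable [set e : KK | J (e.2 - e.1)].
Proof.
move=> mJ; rewrite -[X in measurable X]setTI.
apply: (@measurable_funB _ KK K setT snd fst) => //.
Qed.

Lemma measurable_Ico s t : measurable ([set x | s <= x < t] : set rT).
Proof.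
rewrite (_ : [set x | _] = [set` `[s, t[]); first exact: (@measurable_itv K).
by apply/seteqP; split => x /=; rewrite in_itv.
Qed.

Lemma measurable_left_in s t J : measurable J -> measurable (left_in s t J).
Proof.
move=> mJ; apply: measurableI; last exact: measurable_preimage_sub.
exact: (measurable_preimage_fst (measurable_Ico s t)).
Qed.

Lemma measurable_right_in s t J : measurable J -> measurable (right_in s t J).
Proof.
move=> mJ; apply: measurableI; last exact: measurable_preimage_sub.
exact: (measurable_preimage_snd (measurable_Ico s t)).
Qed.

Lemma measurable_edges_at s J : measurable J -> measurable (edges_at s J).
Proof.
move=> mJ; apply: measurableI; last exact: measurable_preimage_sub.
apply: measurableU.
  exact: (measurable_preimage_fst (@measurable_set1 K s)).
exact: (measurable_preimage_snd (@measurable_set1 K s)).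
Qed.

End Strips.

(** Reindexes [A] by pairs of a value of [f] and an element of its fibre. It later turns a sum over
    points into a count of edges by their left or right ends. *)
Lemma ecard_fibers (K : realType) (U V : choiceType) (f : U -> V) (A : set U) (B : set V) :
  f @` A `<=` B -> (\esum_(r in B) @ecard K U (A `&` f @^-1` [set r]) = @ecard K U A)%E.
Proof.
move=> fAB; rewrite /ecard esum_esum; last by move=> *; exact: lee01.
rewrite (reindex_esum A (B `*`` (fun r => A `&` f @^-1` [set r])) (fun x => (f x, x)))//.
split => [x Ax /=|x y _ _ [_ ->]//|[r x] /= [Br [Ax <-]]].
  by split => //; apply: fAB; exists x.
by exists x.
Qed.

(** * Intensities of a stationary scheme *)

Section Means.
Context {K : realType} {d : measure_display} {T : measurableType d}.
Context (P : probability T K) (R : T -> set K) (M : T -> set (K * K)).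
Hypothesis hms : matching_scheme R M.
Hypothesis hinv : invariant_scheme P R M.
Local Notation rT := (measurableTypeR K).
Local Notation KK := (rT * rT)%type.
Local Notation pc := (pair_config R M).
Local Open Scope ereal_scope.
Implicit Types (D B : set KK) (A : set rT).

Definition mean_edges D : \bar K := \int[P]_w edges_in D (pc w).
Definition mean_points A : \bar K := \int[P]_w points_in A (pc w).

Lemma measurable_edges_scheme D : measurable D ->
  measurable_fun setT (fun w => edges_in D (pc w)).
Proof. by move=> mD; apply: measurableT_comp (measurable_edges_in mD) hms.2. Qed.

Lemma measurable_points_scheme A : measurable A ->
  measurable_fun setT (fun w => points_in A (pc w)).
Proof. by move=> mA; apply: measurableT_comp (measurable_points_in mA) hms.2. Qed.

Lemma mean_edges_ge0 D : 0 <= mean_edges D.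
Proof. by apply: integral_ge0 => w _; exact: edges_in_ge0. Qed.

Lemma mean_edgesID B D : measurable B -> measurable D ->
  mean_edges D = mean_edges (D `&` B) + mean_edges (D `&` ~` B).
Proof.
move=> mB mD; rewrite /mean_edges -ge0_integralD//; last 4 first.
- by move=> *; exact: edges_in_ge0.
- exact: measurable_edges_scheme (measurableI _ _ mD mB).
- by move=> *; exact: edges_in_ge0.
- exact: measurable_edges_scheme (measurableI _ _ mD (measurableC mB)).
by apply: eq_integral => w _; exact: edges_inID.
Qed.

Lemma le_mean_edges D D' : measurable D -> measurable D' -> D `<=` D' ->
  mean_edges D <= mean_edges D'.
Proof.
move=> mD mD' DD'; apply: ge0_le_integral => //.
- by move=> *; exact: edges_in_ge0.
- exact: measurable_edges_scheme.
- exact: measurable_edges_scheme.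
- by move=> w _; exact: le_edges_in.
Qed.

(** Invariance gives [F] and [G] the same law under the scheme, and the integral of a nonnegative
    function depends on its law only. *)
Lemma stationary_integral (F G : config K -> \bar K) (t : K) :
  measurable_fun setT F -> measurable_fun setT G -> (forall c, 0 <= F c) ->
  (forall c, F (translate t c) = G c) ->
  \int[P]_w F (pc w) = \int[P]_w G (pc w).
Proof.
move=> mF mG F0 FG; have G0 c : 0 <= G c by rewrite -FG.
have mFp : measurable_fun setT (F \o pc) by apply: measurableT_comp mF hms.2.
have mGp : measurable_fun setT (G \o pc) by apply: measurableT_comp mG hms.2.
(* The change of variables is restricted to nonnegative values, where the identity is a nonnegative
   integrand. *)
have push (N : T -> \bar K) (mN : measurable_fun setT N) : (forall w, 0 <= N w) ->
    \int[P]_w N w = \int[pushforward P N]_(y in [set y | 0 <= y]) y.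
  move=> N0.
  have NT : N @^-1` [set y | 0 <= y] = setT.
    by apply/seteqP; split => x //= _; exact: N0.
  rewrite (ge0_integral_pushforward mN) ?NT//.
  - rewrite (_ : [set y | _] = [set` `[0%E, +oo%E]]); first exact: emeasurable_itv.
    by apply/seteqP; split => x /=; rewrite in_itv /= leey andbT.
  - by move=> y; rewrite inE.
transitivity (\int[pushforward P (F \o pc)]_(y in [set y | 0 <= y]) y); first exact: push.
transitivity (\int[pushforward P (G \o pc)]_(y in [set y | 0 <= y]) y); last exact/esym/push.
apply: eq_measure_integral => Y mY _; rewrite /pushforward.
have mB : measurable (F @^-1` Y) by rewrite -[X in measurable X]setTI; exact: mF.
transitivity (P ((translate t \o pc) @^-1` (F @^-1` Y))).
  by rewrite (hinv t mB).
by congr (P _); apply/seteqP; split => w /=; rewrite FG.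
Qed.

Lemma mean_edges_translate D (t : K) : measurable D ->
  measurable [set e : KK | D (e.1 + t, e.2 + t)%R] ->
  mean_edges D = mean_edges [set e | D (e.1 + t, e.2 + t)%R].
Proof.
move=> mD mD'; apply: (@stationary_integral _ _ t).
- exact: measurable_edges_in.
- exact: measurable_edges_in.
- by move=> c; exact: edges_in_ge0.
- by move=> c; exact: edges_in_translate.
Qed.

Lemma mean_points_translate A (t : K) : measurable A ->
  measurable [set x : rT | A (x + t)%R] ->
  mean_points A = mean_points [set x | A (x + t)%R].
Proof.
move=> mA mA'; apply: (@stationary_integral _ _ t).
- exact: measurable_points_in.
- exact: measurable_points_in.
- by move=> c; exact: points_in_ge0.
- by move=> c; exact: points_in_translate.
Qed.

Lemma mean_pointsID A A' : measurable A -> measurable A' ->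
  mean_points A = mean_points (A `&` A') + mean_points (A `&` ~` A').
Proof.
move=> mA mA'; rewrite /mean_points -ge0_integralD//; last 4 first.
- by move=> *; exact: points_in_ge0.
- exact: measurable_points_scheme (measurableI _ _ mA mA').
- by move=> *; exact: points_in_ge0.
- exact: measurable_points_scheme (measurableI _ _ mA (measurableC mA')).
by apply: eq_integral => w _; rewrite /points_in (ecardID A') -!setIA.
Qed.

Lemma left_in_split (s t u : K) (J : set rT) : (s <= t <= u)%R -> measurable J ->
  mean_edges (left_in s u J) = mean_edges (left_in s t J) + mean_edges (left_in t u J).
Proof.
move=> /andP[st tu] mJ.
rewrite (@mean_edgesID [set e | (e.1 < t)%R]); last exact: measurable_left_in.
  congr (mean_edges _ + mean_edges _);
    by apply/seteqP; split => e; rewrite /left_in /= => h; set_interval_lra.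
exact: (measurable_preimage_fst (@measurable_itv K `]-oo, t[)).
Qed.

Lemma right_in_split (s t u : K) (J : set rT) : (s <= t <= u)%R -> measurable J ->
  mean_edges (right_in s u J) = mean_edges (right_in s t J) + mean_edges (right_in t u J).
Proof.
move=> /andP[st tu] mJ.
rewrite (@mean_edgesID [set e | (e.2 < t)%R]); last exact: measurable_right_in.
  congr (mean_edges _ + mean_edges _);
    by apply/seteqP; split => e; rewrite /right_in /= => h; set_interval_lra.
exact: (measurable_preimage_snd (@measurable_itv K `]-oo, t[)).
Qed.

Lemma points_split (s t u : K) : (s <= t <= u)%R ->
  mean_points [set x | s <= x < u]%R =
  mean_points [set x | s <= x < t]%R + mean_points [set x | t <= x < u]%R.
Proof.
move=> /andP[st tu].
rewrite (@mean_pointsID _ [set x | x < t]%R); [|exact: measurable_Ico|].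
  congr (mean_points _ + mean_points _);
    by apply/seteqP; split => e /= h; set_interval_lra.
exact: (@measurable_itv K `]-oo, t[).
Qed.

Lemma left_in_shift (s u : K) (J : set rT) : measurable J ->
  mean_edges (left_in s (s + u) J) = mean_edges (left_in 0 u J).
Proof.
move=> mJ; have E : [set e : KK | left_in s (s + u) J (e.1 + s, e.2 + s)%R] = left_in 0 u J.
  by apply/seteqP; split => e; rewrite /left_in /= opprD addrACA subrr addr0 => h;
    set_interval_lra.
by rewrite (@mean_edges_translate _ s) ?E//; exact: measurable_left_in.
Qed.

Lemma right_in_shift (s u : K) (J : set rT) : measurable J ->
  mean_edges (right_in s (s + u) J) = mean_edges (right_in 0 u J).
Proof.
move=> mJ; have E : [set e : KK | right_in s (s + u) J (e.1 + s, e.2 + s)%R] = right_in 0 u J.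
  by apply/seteqP; split => e; rewrite /right_in /= opprD addrACA subrr addr0 => h;
    set_interval_lra.
by rewrite (@mean_edges_translate _ s) ?E//; exact: measurable_right_in.
Qed.

Lemma points_shift (s u : K) :
  mean_points [set x | s <= x < s + u]%R = mean_points [set x | 0 <= x < u]%R.
Proof.
have E : [set x : rT | s <= x + s < s + u]%R = [set x | 0 <= x < u]%R.
  by apply/seteqP; split => e /= h; set_interval_lra.
by rewrite (@mean_points_translate _ s) ?E//; exact: measurable_Ico.
Qed.

(** An additive translation-invariant function of intervals is linear along multiples of a window.
    Left ends, right ends and points are the three instances. *)
Lemma additive_multiple (f : K -> K -> \bar K) (u : K) (n : nat) : (0 <= u)%R ->
  (forall s t v, (s <= t <= v)%R -> f s v = f s t + f t v) ->
  (forall s v, f s (s + v)%R = f 0%R v) -> f 0%R 0%R = 0 -> 0 <= f 0%R u ->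
  f 0%R (u *+ n)%R = n%:R%:E * f 0%R u.
Proof.
move=> u0 fD fT f0 fu0; elim: n => [|n IH]; first by rewrite mulr0n mul0e f0.
rewrite (fD _ (u *+ n)%R); last by rewrite mulrn_wge0//= mulrSr lerDl.
by rewrite mulrSr fT IH -natr1 EFinD ge0_muleDl ?mul1e// ?lee_fin.
Qed.

Lemma mean_edges0 : mean_edges set0 = 0.
Proof.
rewrite /mean_edges; under eq_integral do rewrite /edges_in setI0 ecard0.
exact: integral0.
Qed.

Lemma mean_points0 : mean_points set0 = 0.
Proof.
rewrite /mean_points; under eq_integral do rewrite /points_in setI0 ecard0.
exact: integral0.
Qed.

Lemma left_in_multiple (u : K) (n : nat) (J : set rT) : (0 <= u)%R -> measurable J ->
  mean_edges (left_in 0 (u *+ n) J) = n%:R%:E * mean_edges (left_in 0 u J).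
Proof.
move=> u0 mJ; apply: (@additive_multiple (fun s t => mean_edges (left_in s t J))) => //.
- by move=> s t v stv; exact: left_in_split.
- by move=> s v; exact: left_in_shift.
- rewrite (_ : left_in 0 0 J = set0) ?mean_edges0//.
  by apply/seteqP; split => // e; rewrite /left_in /= => h; exfalso; set_interval_lra.
- exact: mean_edges_ge0.
Qed.

Lemma right_in_multiple (u : K) (n : nat) (J : set rT) : (0 <= u)%R -> measurable J ->
  mean_edges (right_in 0 (u *+ n) J) = n%:R%:E * mean_edges (right_in 0 u J).
Proof.
move=> u0 mJ; apply: (@additive_multiple (fun s t => mean_edges (right_in s t J))) => //.
- by move=> s t v stv; exact: right_in_split.
- by move=> s v; exact: right_in_shift.
- rewrite (_ : right_in 0 0 J = set0) ?mean_edges0//.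
  by apply/seteqP; split => // e; rewrite /right_in /= => h; exfalso; set_interval_lra.
- exact: mean_edges_ge0.
Qed.

Lemma points_multiple (u : K) (n : nat) : (0 <= u)%R ->
  mean_points [set x | 0 <= x < u *+ n]%R = n%:R%:E * mean_points [set x | 0 <= x < u]%R.
Proof.
move=> u0; apply: (@additive_multiple (fun s t => mean_points [set x | s <= x < t]%R)) => //.
- by move=> s t v stv; exact: points_split.
- by move=> s v; exact: points_shift.
- rewrite (_ : [set x | _] = set0) ?mean_points0//.
  by apply/seteqP; split => // e /= h; exfalso; set_interval_lra.
- by apply: integral_ge0 => w _; exact: points_in_ge0.
Qed.

End Means.

Lemma edges_at_split (K : realType) (R : set K) (M : set (K * K)) (s : K) (J : set K) :
  is_matching R M ->
  ecard (M `&` edges_at s J) =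
  (@ecard K _ (M `&` [set e | e.1 = s /\ J (e.2 - e.1)%R]) +
   ecard (M `&` [set e | e.2 = s /\ J (e.2 - e.1)%R]))%E.
Proof.
move=> [M1 _]; rewrite -ecardU.
  by congr ecard; apply/seteqP; split => e /=; rewrite /edges_at /=; tauto.
apply/disj_set2P/seteqP; split => // e [/= [Me [e1 _]] [_ [e2 _]]].
by have [_ _] := M1 _ Me; rewrite e1 e2 ltxx.
Qed.

(** A point lies on at most one edge, so the count is 0 or 1; expected counts at the origin thereby
    become probabilities. *)
Lemma matching_edges_at (K : realType) (R : set K) (M : set (K * K)) (s : K) (J : set K) :
  is_matching R M ->
  @ecard K _ (M `&` edges_at s J) = (\1_[set M' | M' `&` edges_at s J !=set0] M)%:E.
Proof.
move=> [_ M2]; have [M0|/set0P[e Me]] := eqVneq (M `&` edges_at s J) set0.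
  by rewrite M0 ecard0 indicE memNset//= => -[e]; rewrite M0.
rewrite indicE mem_set/=; last by exists e.
rewrite (_ : M `&` _ = [set e]) ?ecard1//.
apply/seteqP; split => [e'|_ ->//].
move: Me => [Me [es _]] [Me' [es' _]]; apply: (M2 _ _ s) => //.
  by case: es' => <-; [left|right].
by case: es => <-; [left|right].
Qed.

(** * The Palm formula for counts of edges and points *)

Section Palm.
Context {K : realType} {d : measure_display} {T : measurableType d}.
Context {P : probability T K} {R : T -> set K} {M : T -> set (K * K)}.
Context {d' : measure_display} {T' : measurableType d'}.
Context {P' : probability T' K} {R' : T' -> set K} {M' : T' -> set (K * K)}.
Hypothesis hms : matching_scheme R M.
Hypothesis hpalm : palm_process P R M P' R' M'.
Local Notation rT := (measurableTypeR K).
Local Notation KK := (rT * rT)%type.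
Implicit Types J : set rT.

Definition root_edge J : set T' := [set w | M' w `&` edges_at 0 J !=set0].

Lemma measurable_root_edge J : measurable J -> measurable (root_edge J).
Proof.
move=> mJ; have [_ [_ mpc] _] := hpalm.
have mE := measurable_edges_at 0 mJ.
rewrite (_ : root_edge J = ~` (pair_config R' M' @^-1`
    [set c : config K | (c.2 `&` edges_at 0 J #= `I_0)%card])).
  apply: measurableC; rewrite -[X in measurable X]setTI; apply: mpc => //.
  by apply: sub_sigma_algebra; right; exists (edges_at 0 J) => //; exists 0%N.
apply/seteqP; split => w /=; rewrite II0 card_eq0.
  by move=> /set0P/negP.
by move=> /negP/set0P.
Qed.

(** Apply the Palm formula to the number of edges at the origin with length in [J]. On the
    stationary side an edge is seen once from its left end and once from its right end. *)
Lemma palm_root_edge J : measurable J ->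
  P' (root_edge J) =
  (mean_edges P R M (left_in 0 1 J) + mean_edges P R M (right_in 0 1 J))%E.
Proof.
move=> mJ; have [_ [matM' _] palm] := hpalm.
have mE := measurable_edges_at 0 mJ.
have := palm (edges_in (edges_at 0 J)) (measurable_edges_in mE) (edges_in_ge0 _).
rewrite (eq_integral (fun w => (\1_(root_edge J) w)%:E)); last first.
  by move=> w _; rewrite /edges_in /= (matching_edges_at _ _ (matM' w)).
rewrite integral_indic//; last exact: measurable_root_edge.
rewrite setIT => <-; rewrite /mean_edges -ge0_integralD//; last 4 first.
- by move=> *; exact: edges_in_ge0.
- exact: measurable_edges_scheme (measurable_left_in _ _ mJ).
- by move=> *; exact: edges_in_ge0.
- exact: measurable_edges_scheme (measurable_right_in _ _ mJ).
apply: eq_integral => w _.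
under eq_esum => r _.
  rewrite edges_in_translate.
  (* Translation by [- r] carries the edges at [r] to edges at the origin with the same lengths. *)
  rewrite (_ : [set e | _] = edges_at r J); last first.
    apply/seteqP; split => e; rewrite /edges_at /= opprD addrACA subrr addr0 => -[h Je];
    (split; last exact: Je); case: h => h; lra.
  rewrite /edges_in (edges_at_split _ _ (hms.1 w)).
  over.
rewrite esumD; [|by move=> *; exact: ecard_ge0..].
have [M1 _] := hms.1 w.
have rI (x : K) : `[0%R, 1%R[%classic x = (0 <= x < 1)%R by rewrite /= in_itv.
(* The sums over the points [r] collect the fibres of [fst] and of [snd]. *)
congr (_ + _)%E.
- rewrite [RHS]/edges_in -[RHS](@ecard_fibers K _ _ fst _ (R w `&` `[0%R, 1%R[)).
    apply: eq_esum => r [_]; rewrite rI => r01; congr ecard; apply/seteqP; split => e /=.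
      by rewrite /left_in /= => -[Me [-> Je]].
    by rewrite /left_in /= => -[[Me [_ Je]] er]; split => //; split.
  by move=> _ [e [/= Me [e01 _]] <-]; split; [have [] := M1 _ Me|rewrite /= in_itv].
- rewrite [RHS]/edges_in -[RHS](@ecard_fibers K _ _ snd _ (R w `&` `[0%R, 1%R[)).
    apply: eq_esum => r [_]; rewrite rI => r01; congr ecard; apply/seteqP; split => e /=.
      by rewrite /right_in /= => -[Me [-> Je]].
    by rewrite /right_in /= => -[[Me [_ Je]] er]; split => //; split.
  by move=> _ [e [/= Me [e01 _]] <-]; split; [have [] := M1 _ Me|rewrite /= in_itv].
Qed.

(** With constant test function 1 the Palm formula equates the intensity with the total mass of
    [P']. *)
Lemma palm_points : mean_points P R M [set x | 0 <= x < 1] = 1%E.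
Proof.
have [_ _ palm] := hpalm.
have := palm (cst 1%E) (measurable_cst _) (fun=> lee01).
rewrite integral_cst// mul1e => H.
apply: etrans (etrans H (probability_setT P')).
apply: eq_integral => w _; rewrite /points_in /ecard; congr esum.
Qed.

(** An unmatched origin has distance [+oo] and lies on no edge, so it belongs to both sides. *)
Lemma matching_distance_gt (x : K) : 0 < x ->
  [set w | (x%:E < matching_distance M' w)%E] = ~` root_edge [set l | 0 < l <= x].
Proof.
move=> x0; apply/seteqP; split => w /=; have [_ [matM' _] _] := hpalm;
  have [M1 M2] := matM' w; rewrite /matching_distance /partner.
- case: xgetP => [y _ [z /= a0z <-]|no _ [e [Me [e0 _]]]].
    move=> xz [e [Me [e0 /andP[l0 lx]]]]; move: xz; rewrite lte_fin ltNge => /negP; apply.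
    have h : endpoint e 0 by case: e0 => <-; [left|right].
    case: a0z => Mz.
      have E : (0, z) = e by apply: (M2 _ _ 0) => //; left.
      by move: l0 lx; rewrite -E /= subr0 => l0 lx; rewrite ger0_norm// ltW.
    have E : (z, 0) = e by apply: (M2 _ _ 0) => //; right.
    by move: l0 lx; rewrite -E /= sub0r => l0 lx; rewrite ler0_norm// -oppr_ge0 ltW.
  case: e0 => e0.
    by apply: (no e.2%:E); exists e.2 => //; left; rewrite -e0 -surjective_pairing.
  by apply: (no e.1%:E); exists e.1 => //; right; rewrite -e0 -surjective_pairing.
- move=> nr; case: xgetP => [y _ [z /= a0z <-]|no]; last by rewrite /= ltry.
  rewrite lte_fin ltNge; apply/negP => zx; apply: nr.
  case: a0z => Mz; have [_ _ /= lt] := M1 _ Mz.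
    exists (0, z); split => //; split; first by left.
    by rewrite /= subr0 lt /= (le_trans (ler_norm _)).
  exists (z, 0); split => //; split; first by right.
  by rewrite /= sub0r oppr_gt0 lt /= (le_trans _ zx)// -normrN ler_norm.
Qed.

End Palm.

(** * Perfectness *)

Lemma adde_idr_eq0 (K : numDomainType) (x y : \bar K) :
  x \is a fin_num -> (x + y = x)%E -> y = 0%E.
Proof.
case: x y => [x| |] [y| |]// _ [] /eqP; rewrite -subr_eq0 addrAC subrr add0r.
by move=> /eqP ->.
Qed.

(** A point is the left end of one edge, the right end of one edge, or unmatched, and these cases
    are exclusive. *)
Lemma matching_points (K : realType) (R : set K) (M : set (K * K)) (s t : K) :
  is_matching R M ->
  @ecard K _ (R `&` [set x | (s <= x < t)%R]) =
  (ecard (M `&` left_in s t setT) + ecard (M `&` right_in s t setT) +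
   ecard (unmatched R M `&` [set x | (s <= x < t)%R]))%E.
Proof.
move=> [M1 M2].
rewrite -(@ecard_image _ _ _ fst (M `&` left_in s t setT)); last first.
  move=> e e' /set_mem [Me _] /set_mem [Me' _] ee'.
  by apply: (M2 _ _ e.1) => //; left.
rewrite -(@ecard_image _ _ _ snd (M `&` right_in s t setT)); last first.
  move=> e e' /set_mem [Me _] /set_mem [Me' _] ee'.
  by apply: (M2 _ _ e.2) => //; right.
rewrite -ecardU; last first.
  apply/disj_set2P/seteqP; split => // _ [[e [Me _] <-] [e' [Me' _] ee']].
  have E : e' = e by apply: (M2 _ _ e.1) => //; [right|left].
  by have [_ _] := M1 _ Me; rewrite -E in ee' *; rewrite ee' ltxx.
rewrite -ecardU; last first.
  apply/disj_set2P/seteqP; split => // _ [[[e [Me _] <-]|[e [Me _] <-]] [[_ u] _]].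
    by apply: (u _ Me); left.
  by apply: (u _ Me); right.
congr ecard; apply/seteqP; split => x /=.
  move=> [Rx xst].
  have [ux|] := pselect (unmatched R M x); first by right.
  move=> nu; left.
  have [e [Me [xe|xe]]] : exists e, M e /\ endpoint e x.
    by apply: contrapT => ne; apply: nu; split => // e Me ex; apply: ne; exists e.
    by left; exists e => //; split => //; split => //; rewrite -xe.
  by right; exists e => //; split => //; split => //; rewrite -xe.
move=> [[[e [Me [est _]] <-]|[e [Me [est _]] <-]]|[[Rx _] xst]]; split => //;
  by have [] := M1 _ Me.
Qed.

Section Perfect.
Context {K : realType} {d : measure_display} {T : measurableType d}.
Context {P : probability T K} {R : T -> set K} {M : T -> set (K * K)}.
Context {d' : measure_display} {T' : measurableType d'}.
Context {P' : probability T' K} {R' : T' -> set K} {M' : T' -> set (K * K)}.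
Context {g : parameter K}.
Hypothesis hlf : forall w, locally_finite (R w).
Hypothesis hms : matching_scheme R M.
Hypothesis hinv : invariant_scheme P R M.
Hypothesis hmin : minimal_scheme P g R M.
Hypothesis hpalm : palm_process P R M P' R' M'.
Local Notation rT := (measurableTypeR K).
Local Notation KK := (rT * rT)%type.
Local Notation pc := (pair_config R M).
Local Notation mean := (mean_edges P R M).

(** On average [[0, n)] contains [n] points, of which [n * alpha] are matched, and almost surely at
    most one is unmatched. So [n <= n * alpha + 1] for all [n], which forces [alpha = 1]. *)
Lemma root_edge_full : P' (root_edge (M' := M') setT) = 1%E.
Proof.
apply/eqP; rewrite eq_le probability_le1//=; last exact: (measurable_root_edge hpalm).
set alpha := P' _.
have a0 : (0 <= alpha)%E by exact: measure_ge0.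
have a1 : (alpha <= 1)%E by apply: probability_le1; exact: (measurable_root_edge hpalm).
have key (n : nat) : (n%:R%:E <= n%:R%:E * alpha + 1)%E.
  have H : mean_points P R M [set x | 0 <= x < 1 *+ n] = n%:R%:E.
    by rewrite (points_multiple hms hinv)// (palm_points hpalm) mule1.
  rewrite -[leLHS]H /alpha (palm_root_edge hms hpalm)// ge0_muleDr ?mean_edges_ge0//.
  rewrite -(left_in_multiple hms hinv)// -(right_in_multiple hms hinv)//.
  rewrite -[X in (_ <= _ + X)%E](probability_setT P).
  rewrite -[X in (_ <= _ + X)%E]mul1e -integral_cst//.
  have mL := measurable_edges_scheme hms (measurable_left_in 0 (1 *+ n) (@measurableT _ rT)).
  have mR := measurable_edges_scheme hms (measurable_right_in 0 (1 *+ n) (@measurableT _ rT)).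
  rewrite /mean_edges -ge0_integralD//; try by move=> *; exact: edges_in_ge0.
  rewrite -ge0_integralD//; last 2 first.
  - by move=> w _; rewrite adde_ge0 ?edges_in_ge0.
  - exact: emeasurable_funD.
  apply: ae_ge0_le_integral => //.
  - by move=> w _; exact: points_in_ge0.
  - exact: (measurable_points_scheme hms (measurable_Ico _ _)).
  - by move=> w _; rewrite !adde_ge0 ?edges_in_ge0.
  - by apply: emeasurable_funD => //; exact: emeasurable_funD.
  apply: filterS hmin => w mw _; rewrite /points_in (matching_points _ _ (hms.1 w)).
  rewrite leeD2l//; apply: ecard_le1 => x y [ux _] [uy _].
  exact: (minimal_unmatched_unique mw ux uy).
case E : alpha a0 a1 key => [a| |]//; rewrite !lee_fin => a0 a1 key.
rewrite leNgt; apply/negP => alt.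
have a1' : 0 < 1 - a by rewrite subr_gt0.
(* Any [n] above [1 / (1 - a)] violates the inequality. *)
have := key (Num.truncn ((1 - a)^-1)).+1; rewrite -EFinM -EFinD lee_fin => k.
have := truncnS_gt ((1 - a)^-1); set N := (_.+1)%:R => h.
move: h; rewrite -(ltr_pM2r a1') mulVf ?gt_eqF// => h.
by rewrite -/N in k; clear E; lra.
Qed.


(** The nonnegative difference has integral zero; the finiteness assumptions allow the subtraction
    and the cancellation. *)
Lemma ge0_le_ae_eq (f h : T -> \bar K) : measurable_fun setT f -> measurable_fun setT h ->
  (forall w, 0 <= h w)%E -> (forall w, h w <= f w)%E -> (forall w, h w \is a fin_num) ->
  (\int[P]_w f w = \int[P]_w h w)%E -> (\int[P]_w h w)%E \is a fin_num ->
  \forall w \ae P, f w = h w.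
Proof.
move=> mf mh h0 hf hfin ifh ifin.
have mfh : measurable_fun setT (f \- h)%E by exact: emeasurable_funB.
have fh0 w : (0 <= (f \- h)%E w)%E by rewrite /= sube_ge0 ?hfin ?orbT.
have : (\int[P]_w (f \- h)%E w = 0)%E.
  have : (\int[P]_w (h w + (f \- h)%E w) = \int[P]_w h w)%E.
    rewrite -ifh; apply: eq_integral => w _ /=.
    by rewrite addeC subeK.
  by rewrite ge0_integralD//; exact: adde_idr_eq0.
rewrite (eq_integral (fun w => `|(f \- h)%E w|)%E); last first.
  by move=> w _; rewrite gee0_abs.
move=> /(ae_eq_integral_abs _ measurableT mfh).
apply: filterS => w /(_ I) /= E.
by rewrite -(subeK (f w) (hfin w)) E add0e.
Qed.

Lemma finite_window (w : T) (s t : K) : finite_set (R w `&` [set x | s <= x < t]).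
Proof.
apply: sub_finite_set (hlf w s t) => x [Rx /= /andP[sx xt]]; split => //.
by rewrite /= in_itv /= sx ltW.
Qed.

(** Points and matched points of the window have the same finite mean, and the former are at least
    as many as the latter, so almost surely the numbers agree. *)
Lemma perfect_window (n : nat) : \forall w \ae P,
  unmatched (R w) (M w) `&` [set x | - n%:R <= x < n%:R] = set0.
Proof.
pose L := left_in (- n%:R : K) n%:R setT; pose Rt := right_in (- n%:R : K) n%:R setT.
pose I := [set x : K | - n%:R <= x < n%:R].
(* The window is made of [2n] unit steps from its left end, the form in which the translation lemmas
   apply. *)
have nE : n%:R = - n%:R + 1 *+ n.*2 :> K by rewrite -addnn mulrnDr addKr.
have mL := measurable_edges_scheme hms (measurable_left_in (- n%:R) n%:R (@measurableT _ rT)).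
have mR := measurable_edges_scheme hms (measurable_right_in (- n%:R) n%:R (@measurableT _ rT)).
have sum w := matching_points (- n%:R) n%:R (hms.1 w).
have fI w : ecard (R w `&` I) \is a @fin_num K by apply: ecard_finite; exact: finite_window.
have le w : (edges_in L (pc w) + edges_in Rt (pc w) <= points_in I (pc w))%E.
  by rewrite /points_in sum leeDl// ecard_ge0.
have fin w : (edges_in L (pc w) + edges_in Rt (pc w))%E \is a fin_num.
  rewrite ge0_fin_numE ?adde_ge0 ?edges_in_ge0// (le_lt_trans (le w))//.
  by rewrite -ge0_fin_numE ?ecard_ge0//; exact: fI.
have int1 : mean_points P R M I = (n.*2%:R)%:E.
  rewrite /I [X in [set x | _ <= x < X]]nE (points_shift hms hinv).
  by rewrite (points_multiple hms hinv)// (palm_points hpalm) mule1.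
have int2 : (\int[P]_w (edges_in L (pc w) + edges_in Rt (pc w)) = (n.*2%:R)%:E)%E.
  rewrite ge0_integralD//; try by move=> *; exact: edges_in_ge0.
  rewrite -[X in (X + _)%E]/(mean _) -[X in (_ + X)%E]/(mean _) /L /Rt.
  rewrite [X in left_in _ X]nE [X in right_in _ X]nE.
  rewrite (left_in_shift hms hinv)// (right_in_shift hms hinv)//.
  rewrite (left_in_multiple hms hinv)// (right_in_multiple hms hinv)//.
  rewrite -ge0_muleDr ?mean_edges_ge0// -(palm_root_edge hms hpalm)//.
  by rewrite root_edge_full mule1.
have := @ge0_le_ae_eq (fun w => points_in I (pc w)) _
  (measurable_points_scheme hms (measurable_Ico _ _)) (emeasurable_funD mL mR).
rewrite int2 => H.
have {}H := H (fun w => adde_ge0 (edges_in_ge0 _ _) (edges_in_ge0 _ _)) le fin int1 isT.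
apply: filterS H => w; rewrite /points_in sum => E.
have u0 : @ecard K _ (unmatched (R w) (M w) `&` I) = 0%E.
  exact: adde_idr_eq0 (fin w) E.
by move/(ecard_eqn (K := K) _ 0): u0; rewrite II0 card_eq0 => /eqP.
Qed.

Lemma perfect : \forall w \ae P, unmatched (R w) (M w) = set0.
Proof.
apply: filterS (ae_foralln perfect_window) => w H.
apply/seteqP; split => // x ux.
rewrite -(H (Num.truncn `|x|).+1); split => //=.
have := truncnS_gt `|x|; rewrite ltr_norml => /andP[h ->].
by rewrite ltW.
Qed.

(** The two events differ only where the origin lies on no edge, which has probability zero. *)
Lemma matching_distance_tail (x : K) : 0 < x ->
  P' [set w | (x%:E < matching_distance M' w)%E] =
  P' (root_edge (M' := M') [set l | x < l]).
Proof.
move=> x0; rewrite (matching_distance_gt hpalm)//.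
have [_ [matM' _] _] := hpalm.
have mJ : measurable ([set l | 0 < l <= x] : set rT).
  rewrite (_ : [set l | _] = [set` `]0, x]]); first exact: (@measurable_itv K).
  by apply/seteqP; split => l /=; rewrite in_itv.
set A := root_edge (M' := M') [set l | 0 < l <= x]; set B := root_edge (M' := M') setT.
have mA : measurable A by exact: (measurable_root_edge hpalm).
have mB : measurable B by exact: (measurable_root_edge hpalm).
have -> : root_edge (M' := M') [set l | x < l] = B `&` ~` A.
  apply/seteqP; split => w /=.
    move=> [e [Me [e0 xe]]]; split; first by exists e.
    move=> [e' [Me' [e0' /andP[_ xe']]]].
    have E : e = e'.
      have [_ M2] := matM' w; apply: (M2 _ _ 0) => //.
        by case: e0 => <-; [left|right].
      by case: e0' => <-; [left|right].
    by rewrite -E leNgt xe in xe'.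
  move=> [[e [Me [e0 _]]] nA]; exists e; split => //; split => //=.
  rewrite ltNge; apply/negP => ex; apply: nA; exists e; split => //; split => //=.
  by have [M1 _] := matM' w; have [_ _] := M1 _ Me; rewrite ex andbT subr_gt0.
have B0 : P' (~` B) = 0%E.
  by rewrite probability_setC// root_edge_full subee.
apply/eqP; rewrite eq_le; apply/andP; split; last first.
  apply: le_measure; rewrite ?inE//.
  - by apply: measurableI => //; exact: measurableC.
  - exact: measurableC.
rewrite -[leRHS]adde0 -B0 (le_trans _ (measureU2 _ _ _))//; last 2 first.
- by apply: measurableI => //; exact: measurableC.
- exact: measurableC.
apply: le_measure; rewrite ?inE//.
- exact: measurableC.
- by apply: measurableU; [apply: measurableI => //|]; exact: measurableC.
- by move=> w nA; have [Bw|nB] := pselect (B w); [left|right].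
Qed.

End Perfect.

(** * Long edges *)

Lemma measurable_Ioc (K : realType) (s t : K) :
  measurable ([set x | s < x <= t] : set (measurableTypeR K)).
Proof.
rewrite (_ : [set x | _] = [set` `]s, t]]); first exact: (@measurable_itv K).
by apply/seteqP; split => x /=; rewrite in_itv.
Qed.

Lemma measurable_Ioy (K : realType) (s : K) :
  measurable ([set x | s < x] : set (measurableTypeR K)).
Proof.
rewrite (_ : [set x | _] = [set` `]s, +oo[]); first exact: (@measurable_itv K).
by apply/seteqP; split => x /=; rewrite in_itv /= andbT.
Qed.

Section LongEdges.
Context {K : realType}.
Implicit Types (R : set K) (M : set (K * K)) (g : parameter K).

Lemma ecard_close_long_le1 R M g (x : K) (D : set (K * K)) : minimal g R M ->
  (forall e, D e -> x < elen e) ->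
  (forall e f, D e -> D f -> `|e.1 - f.1| < x /\ `|e.2 - f.2| < x) ->
  (@ecard K _ (M `&` D) <= 1)%E.
Proof.
move=> mM Dx Dc; apply: ecard_le1 => e f [Me De] [Mf Df].
have [d1 d2] := Dc _ _ De Df.
exact: (no_close_long_edges mM Me Mf (Dx _ De) (Dx _ Df)).
Qed.

(** Right ends lie strictly between [x] and [3x]. Cutting at [2x] leaves two classes, and edges of
    one class have both ends at distance below [x]. *)
Lemma ecard_left_le2 R M g (x s : K) : minimal g R M -> s <= x ->
  (@ecard K _ (M `&` left_in 0 s [set l | (x < l <= 2 * x)%R]) <= 2%:R%:E)%E.
Proof.
move=> mM sx; set D := left_in _ _ _.
have sum : (@ecard K _ (M `&` D) <= 1 + 1)%E; last first.
  by rewrite (le_trans sum)// -EFinD lee_fin -natr1.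
have E X : M `&` D `&` X = M `&` (D `&` X) := esym (setIA _ _ _).
rewrite (ecardID [set e | e.2 < 2 * x]) !E; apply: leeD;
  apply: (ecard_close_long_le1 mM (x := x)).
- by move=> e [[_ /andP[xe _]] _]; exact: xe.
- move=> e f; rewrite /D /left_in /= !ltr_norml => h1 h2; set_interval_lra.
- by move=> e [[_ /andP[xe _]] _]; exact: xe.
- move=> e f; rewrite /D /left_in /= !ltr_norml => h1 h2; set_interval_lra.
Qed.

(** Left ends lie in [[-2x, 0)], which is cut at [-x] for the same reason. *)
Lemma ecard_right_le2 R M g (x s : K) : minimal g R M -> s <= x ->
  (@ecard K _ (M `&` right_in 0 s [set l | (x < l <= 2 * x)%R]) <= 2%:R%:E)%E.
Proof.
move=> mM sx; set D := right_in _ _ _.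
have sum : (@ecard K _ (M `&` D) <= 1 + 1)%E; last first.
  by rewrite (le_trans sum)// -EFinD lee_fin -natr1.
have E X : M `&` D `&` X = M `&` (D `&` X) := esym (setIA _ _ _).
rewrite (ecardID [set e | e.1 < - x]) !E; apply: leeD;
  apply: (ecard_close_long_le1 mM (x := x)).
- by move=> e [[_ /andP[xe _]] _]; exact: xe.
- move=> e f; rewrite /D /right_in /= !ltr_norml => h1 h2; set_interval_lra.
- by move=> e [[_ /andP[xe _]] _]; exact: xe.
- move=> e f; rewrite /D /right_in /= !ltr_norml => h1 h2; set_interval_lra.
Qed.
End LongEdges.

(** * Summing the tail over dyadic scales *)

Section Tail.
Context {K : realType} {d : measure_display} {T : measurableType d}.
Context {P : probability T K} {R : T -> set K} {M : T -> set (K * K)}.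
Context {d' : measure_display} {T' : measurableType d'}.
Context {P' : probability T' K} {R' : T' -> set K} {M' : T' -> set (K * K)}.
Context {g : parameter K}.
Hypothesis hms : matching_scheme R M.
Hypothesis hinv : invariant_scheme P R M.
Hypothesis hmin : minimal_scheme P g R M.
Hypothesis hpalm : palm_process P R M P' R' M'.
Local Notation rT := (measurableTypeR K).
Local Notation root_edge := (root_edge (M' := M')).
Local Notation mean := (mean_edges P R M).

Lemma mean_edges_le (D : set (rT * rT)) (c : K) : measurable D -> 0 <= c ->
  (\forall w \ae P, (edges_in D (pair_config R M w) <= c%:E)%E) ->
  (mean D <= c%:E)%E.
Proof.
move=> mD c0 H; rewrite -[leRHS]mule1 -(probability_setT P) -integral_cst//.
apply: ae_ge0_le_integral => //.
- by move=> *; exact: edges_in_ge0.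
- exact: (measurable_edges_scheme hms mD).
- by apply: filterS H.
Qed.

(** Lengths above [x] are at most [2x] or exceed it; the first case is controlled by counting in a
    window of length [floor x]. *)
Lemma dyadic_tail (x : K) : 1 <= x ->
  (P' (root_edge [set l | (x < l)%R]) <=
   (8 / x)%:E + P' (root_edge [set l | (2 * x < l)%R]))%E.
Proof.
move=> x1; have x0 := lt_le_trans ltr01 x1.
set J := [set l | x < l <= 2 * x]; have mJ : measurable (J : set rT) := measurable_Ioc _ _.
have mE (A : set rT) : measurable A -> measurable (root_edge A).
  exact: (measurable_root_edge hpalm).
have U : (P' (root_edge J `|` root_edge [set l | (2 * x < l)%R]) <=
    P' (root_edge J) + P' (root_edge [set l | (2 * x < l)%R]))%E.
  exact: measureU2 (mE _ mJ) (mE _ (measurable_Ioy (2 * x))).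
move: U; have <- : root_edge [set l | x < l] = root_edge J `|` root_edge [set l | 2 * x < l].
  apply/seteqP; split => w.
    move=> [e [Me [e0 /= xe]]]; have [ex|ex] := leP (e.2 - e.1) (2 * x).
      by left; exists e; split => //; split => //; rewrite /J /= xe.
    by right; exists e.
  move=> [] [e [Me [e0 /= h]]]; exists e; split => //; split => //=.
    by case/andP: h.
  by apply: lt_trans h; rewrite mulr_natl mulr2n ltrDl.
move=> /le_trans; apply; rewrite leeD2r//.
set n := Num.truncn x.
have n1 : (0 < n)%N by rewrite truncn_gt0.
have nx : n%:R <= x by rewrite truncn_le// ltW.
have xn : x < n.+1%:R := truncnS_gt x.
have n0 : 0 < n%:R :> K by rewrite ltr0n.
(* The window [[0, n)] holds at most two left ends and at most two right ends, and consists of [n]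
   unit windows. *)
have key : (n%:R%:E * P' (root_edge J) <= 4%:R%:E)%E.
  rewrite (palm_root_edge hms hpalm)// ge0_muleDr ?mean_edges_ge0//.
  rewrite -(left_in_multiple hms hinv)// -(right_in_multiple hms hinv)//.
  rewrite (natrD K 2 2) EFinD leeD//; apply: mean_edges_le => //.
  - exact: measurable_left_in.
  - by apply: filterS hmin => w mw; exact: (ecard_left_le2 mw nx).
  - exact: measurable_right_in.
  - by apply: filterS hmin => w mw; exact: (ecard_right_le2 mw nx).
have fin : P' (root_edge J) \is a fin_num := fin_num_measure P' _ (mE _ mJ).
have p0 : 0 <= fine (P' (root_edge J)) by apply: fine_ge0.
move: key p0; rewrite -(fineK fin) -EFinM !lee_fin /=; set p := fine _ => key p0.
rewrite ler_pdivlMr// (le_trans (ler_wpM2l p0 (ltW xn)))//.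
(* Since [x < n + 1 <= 2n], the bound [4 / n] becomes [8 / x]. *)
have n1' : 1 <= n%:R :> K by rewrite ler1n.
rewrite -natr1; nra.
Qed.

(** Telescoping: [8 / y = 16 / y - 16 / (2y)] at each scale [y = 2^k x]. *)
Lemma dyadic_tail_iter (x : K) (k : nat) : 1 <= x ->
  (P' (root_edge [set l | (x < l)%R]) <=
   (16 / x - 16 / (2 ^+ k * x))%:E + P' (root_edge [set l | (2 ^+ k * x < l)%R]))%E.
Proof.
move=> x1; have x0 := lt_le_trans ltr01 x1; elim: k => [|k IH].
  by rewrite expr0 mul1r subrr add0e.
have k1 : 1 <= 2 ^+ k :> K by rewrite exprn_ege1// ler1n.
have kx : 1 <= 2 ^+ k * x by rewrite -[leLHS]mulr1 ler_pM.
apply: (le_trans IH); apply: (le_trans (leeD2l _ (dyadic_tail kx))).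
rewrite addeA -EFinD mulrA -exprS leeD2r// lee_fin exprS.
have -> : 16 / (2 * 2 ^+ k * x) = 8 / (2 ^+ k * x).
  have k0 : 2 ^+ k != 0 :> K by rewrite expf_neq0// pnatr_eq0.
  by field; rewrite k0 gt_eqF.
lra.
Qed.

(** The events decrease to the empty set, since the origin lies on at most one edge and that edge
    has finite length. *)
Lemma tail_cvg0 (x : K) : 1 <= x ->
  (fun k => P' (root_edge [set l | (2 ^+ k * x < l)%R])) @ \oo --> 0%E.
Proof.
move=> x1; have x0 := lt_le_trans ltr01 x1.
pose F k := root_edge [set l | (2 ^+ k * x < l)%R].
have mF k : measurable (F k) by apply: (measurable_root_edge hpalm); exact: measurable_Ioy.
have F0 : \bigcap_k F k = set0.
  apply/seteqP; split => // w H; have [_ [matM' _] _] := hpalm; have [_ M2] := matM' w.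
  have [e [Me [e0 _]]] := H 0%N I.
  (* This scale [k] exceeds the length of [e], and [k <= 2^k x] because [x >= 1]. *)
  have [e' [Me' [e0' /=]]] := H (Num.truncn (elen e)).+1 I.
  have E : e' = e.
    apply: (M2 _ _ 0) => //; first by case: e0' => <-; [left|right].
    by case: e0 => <-; [left|right].
  rewrite E ltNge => /negP; apply; rewrite -/(elen e) (le_trans (ltW (truncnS_gt _)))//.
  set k := (_.+1); have h : k%:R <= 2 ^+ k :> K by rewrite -natrX ler_nat ltnW// ltn_expl.
  by rewrite (le_trans h)// -[leLHS]mulr1 ler_pM.
have := @nonincreasing_cvg_mu _ _ _ P' F.
rewrite F0 measure0; apply => //.
- by rewrite (le_lt_trans (probability_le1 P' (mF 0%N)))// ltry.
- move=> k l kl; rewrite subsetEset => w [e [Me [e0 /= h]]].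
  exists e; split => //; split => //=; apply: le_lt_trans h.
  by rewrite ler_pM2r// ler_eXn2l// ltr1n.
Qed.

Lemma tail_bound (x : K) : 1 <= x ->
  (P' (root_edge [set l | (x < l)%R]) <= (16 / x)%:E)%E.
Proof.
move=> x1; have x0 := lt_le_trans ltr01 x1.
apply/lee_addgt0Pr => eps eps0.
have /fine_cvgP [_ /cvgrPdist_lt /(_ eps eps0)] := tail_cvg0 x1.
move=> [k _ /(_ k (leqnn k))] /=; rewrite sub0r normrN => h.
apply: (le_trans (dyadic_tail_iter k x1)); apply: leeD.
  rewrite lee_fin gerBl divr_ge0// mulr_ge0 ?exprn_ge0// ltW//.
have m : measurable (root_edge [set l | (2 ^+ k * x < l)%R]).
  by apply: (measurable_root_edge hpalm); exact: measurable_Ioy.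
rewrite -(fineK (fin_num_measure P' _ m)) lee_fin ltW//.
exact: le_lt_trans (ler_norm _) h.
Qed.

End Tail.

(** * Matchings of consecutive points *)

Section Parity.
Context {K : realType}.
Implicit Types (R : set K) (M : set (K * K)) (s t x : K).

(** An edge ending at [t] crosses [t], one starting at [t] does not; this fits the windows
    [[s, t)]. *)
Definition crossing t : set (K * K) := [set e | e.1 < t <= e.2].
Definition spanning s t : set (K * K) := [set e | e.1 < s /\ t <= e.2].
Definition npts R s t : nat := #|` fset_set (R `&` [set x | s <= x < t])|.

(** The properties that parameters at least 1 give almost surely: every edge joins neighbouring
    points. *)
Definition consecutive_matching R M : Prop :=
  [/\ locally_finite R, is_matching R M, unmatched R M = set0 &
      forall e x, M e -> R x -> ~ (e.1 < x < e.2)].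

(** Of two edges over [t], the later left end would lie inside the other edge. *)
Lemma crossing_unique R M t e f : consecutive_matching R M ->
  (M `&` crossing t) e -> (M `&` crossing t) f -> e = f.
Proof.
move=> [_ [M1 M2] _ nb] [Me /andP[et te]] [Mf /andP[ft tf]].
have [[Re _ _] [Rf _ _]] := (M1 _ Me, M1 _ Mf).
have [lt|lt|eq] := ltgtP e.1 f.1.
- by exfalso; apply: (nb e f.1) => //; rewrite lt (lt_le_trans ft te).
- by exfalso; apply: (nb f e.1) => //; rewrite lt (lt_le_trans et tf).
- by apply: (M2 _ _ e.1) => //; left.
Qed.

(** The edge over [t] ends at a point of [R] and has no point inside, so it covers [[t, t + x)]
    exactly when this gap is void. *)
Lemma spanning_crossing R M t x : consecutive_matching R M -> 0 <= x ->
  (M `&` spanning t (t + x) !=set0) <->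
  (M `&` crossing t !=set0 /\ R `&` [set y | t <= y < t + x] = set0).
Proof.
move=> [_ [M1 M2] _ nb] x0; split.
  move=> [e [Me [et te]]]; split.
    by exists e; split => //; rewrite /crossing /= et (le_trans _ te)// lerDl.
  apply/seteqP; split => // y [Ry /andP[ty yt]]; apply: (nb e y) => //.
  by rewrite (lt_le_trans et ty) (lt_le_trans yt te).
move=> [[e [Me /andP[et te]]] R0]; exists e; split => //; split => //.
rewrite leNgt; apply/negP => ex.
have [_ Re _] := M1 _ Me.
by rewrite -[False]/(set0 e.2) -R0; split => //; rewrite /= te.
Qed.

Definition crossing_sign M t : K :=
  if `[< M `&` crossing t !=set0 >] then -1 else 1.

Lemma crossing_sign_ecard R M t : consecutive_matching R M ->
  exists n : nat, @ecard K _ (M `&` crossing t) = n%:R%:E /\ crossing_sign M t = (-1) ^+ n.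
Proof.
move=> cM; rewrite /crossing_sign; case: asboolP => [[e Me]|M0].
  exists 1%N; split => //; rewrite -(ecard1 e); congr ecard.
  by apply/seteqP; split => [f Mf|_ ->//]; exact: (crossing_unique cM Mf Me).
exists 0%N; split => //; rewrite (_ : M `&` _ = set0) ?ecard0//.
by apply/seteqP; split => // e Me; apply: M0; exists e.
Qed.

Lemma ecard_nat (U : choiceType) (A : set U) : finite_set A ->
  exists n : nat, @ecard K U A = n%:R%:E.
Proof. by move=> fA; exists (#|` fset_set A|); exact: ecard_fset. Qed.

Lemma ecard_npts R s t : locally_finite R ->
  @ecard K _ (R `&` [set x | s <= x < t]) = (npts R s t)%:R%:E.
Proof.
move=> lf; apply: ecard_fset; apply: sub_finite_set (lf s t) => x [Rx /= /andP[sx xt]].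
by split => //=; rewrite in_itv /= sx ltW.
Qed.

Lemma finite_crossing R M t : consecutive_matching R M -> finite_set (M `&` crossing t).
Proof.
move=> cM; have [n [En _]] := crossing_sign_ecard t cM.
by apply/finite_setP; exists n; apply/(ecard_eqn (K := K)).
Qed.

(* Every point of [[s, t)] lies on an edge inside [[s, t)], on one crossing [s]
   only, or on one crossing [t] only; edges inside contribute two points. *)
Lemma crossing_parity R M s t : consecutive_matching R M -> s <= t ->
  crossing_sign M s * crossing_sign M t = (-1) ^+ npts R s t.
Proof.
move=> cM st; have [lf mM u0 nb] := cM; have [M1 M2] := mM.
have [cs [Ecs ->]] := crossing_sign_ecard s cM.
have [ct [Ect ->]] := crossing_sign_ecard t cM.
have EN := matching_points s t mM.
rewrite u0 set0I ecard0 adde0 ecard_npts// in EN.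
(* Edges meeting the window: [Xb] crosses [s] only, [Xc] crosses both ends, [Xd] crosses [t] only,
   and [Xa] below lies inside. *)
pose Xb := M `&` (crossing s `&` [set e | e.2 < t]).
pose Xc := M `&` (crossing s `&` ~` [set e | e.2 < t]).
pose Xd := M `&` (crossing t `&` ~` [set e | e.1 < s]).
have fb : finite_set Xb by apply: sub_finite_set (finite_crossing s cM) => e [? []].
have fc : finite_set Xc by apply: sub_finite_set (finite_crossing s cM) => e [? []].
have fd : finite_set Xd by apply: sub_finite_set (finite_crossing t cM) => e [? []].
have e1 : @ecard K _ (M `&` crossing s) = (ecard Xb + ecard Xc)%E.
  by rewrite (ecardID [set e | e.2 < t]) -!setIA.
have e2 : @ecard K _ (M `&` crossing t) = (ecard Xc + ecard Xd)%E.
  rewrite (ecardID [set e | e.1 < s]); congr (_ + _)%E; congr ecard.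
    rewrite /Xc /crossing; apply/seteqP; split => e /= h; set_interval_lra.
  by rewrite -setIA.
pose Xa := M `&` [set e | s <= e.1 /\ e.2 < t].
have e3 : @ecard K _ (M `&` left_in s t setT) = (ecard Xa + ecard Xd)%E.
  rewrite (ecardID [set e | e.2 < t]); congr (_ + _)%E; congr ecard.
    rewrite /Xa /left_in; apply/seteqP; split => e /= h; have Me : M e by tauto.
      by have [_ _ lt] := M1 _ Me; set_interval_lra.
    by have [_ _ lt] := M1 _ Me; set_interval_lra.
  by rewrite /Xd /crossing /left_in; apply/seteqP; split => e /= h; set_interval_lra.
have e4 : @ecard K _ (M `&` right_in s t setT) = (ecard Xa + ecard Xb)%E.
  rewrite (ecardID [set e | s <= e.1]); congr (_ + _)%E; congr ecard.
    rewrite /Xa /right_in; apply/seteqP; split => e /= h; have Me : M e by tauto.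
      by have [_ _ lt] := M1 _ Me; set_interval_lra.
    by have [_ _ lt] := M1 _ Me; set_interval_lra.
  by rewrite /Xb /crossing /right_in; apply/seteqP; split => e /= h; set_interval_lra.
have fa : finite_set Xa.
  have : (@ecard K _ Xa < +oo)%E.
    rewrite (@le_lt_trans _ _ ((npts R s t)%:R%:E))// ?ltry//.
    by rewrite EN e3 -addeA leeDl// adde_ge0 ?ecard_ge0.
  by apply: contraPP => /(ecard_infinite (K := K)) ->.
have [[na Ea] [nb' Eb] [nc Ec] [nd Ed]] :=
  And4 (ecard_nat fa) (ecard_nat fb) (ecard_nat fc) (ecard_nat fd).
(* In cardinalities, [s] is crossed [b + c] times, [t] is crossed [c + d] times, and the window has
   [2a + b + d] points: the parities agree. *)
move: e1 e2 EN; rewrite e3 e4 Ecs Ect Ea Eb Ec Ed -!EFinD -!natrD.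
move=> [] /eqP; rewrite eqr_nat => /eqP -> [] /eqP; rewrite eqr_nat => /eqP -> [] /eqP.
rewrite eqr_nat => /eqP ->.
have sgn m n : odd m = odd n -> (-1) ^+ m = (-1) ^+ n :> K.
  by move=> mn; rewrite -signr_odd mn signr_odd.
rewrite -exprD; apply: sgn; rewrite !oddD.
by case: (odd na); case: (odd nb'); case: (odd nc); case: (odd nd).
Qed.

Definition void_set R s x : Prop := R `&` [set y | s <= y < s + x] = set0.

(** The crossing sign at [t] restricted to the event that the gap is void. It is written with
    [spanning] so that its mean yields the intensity of spanning edges. *)
Definition gap_sign R M t x : K :=
  `[< void_set R t x >]%:R * (1 - 2 * `[< M `&` spanning t (t + x) !=set0 >]%:R).

Lemma gap_signE R M t x : consecutive_matching R M -> 0 <= x ->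
  gap_sign R M t x = `[< void_set R t x >]%:R * crossing_sign M t.
Proof.
move=> cM x0; rewrite /gap_sign /crossing_sign.
have [/asboolP v|/asboolPn v] := boolP `[< void_set R t x >].
  have [c|c] := pselect (M `&` crossing t !=set0).
    by rewrite !asboolT//=; [lra|apply/(spanning_crossing _ cM x0)].
  by rewrite !asboolF//=; [lra|move=> /(spanning_crossing _ cM x0)[]].
by rewrite !mul0r.
Qed.

(** When [[s, s + x)] is void, only points of [[s + x, t)] contribute to the parity, and this
    interval is disjoint from both gaps. *)
Lemma gap_sign_mul R M s t x : consecutive_matching R M -> 0 <= x -> s + x <= t ->
  gap_sign R M s x * gap_sign R M t x =
  `[< void_set R s x >]%:R * `[< void_set R t x >]%:R * (-1) ^+ npts R (s + x) t.
Proof.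
move=> cM x0 sxt; have st : s <= t by rewrite (le_trans _ sxt)// lerDl.
rewrite !(gap_signE _ cM)// mulrACA (crossing_parity cM st).
have [/asboolP v|_] := boolP `[< void_set R s x >]; last by rewrite !mul0r.
congr (_ * _ ^+ _); rewrite /npts; congr (#|` fset_set _|).
apply/seteqP; split => y [Ry /= yy]; split => //=; last by set_interval_lra.
move: yy => /andP[sy ->]; rewrite andbT leNgt; apply/negP => yx.
by rewrite -[False]/(set0 y) -v; split => //=; rewrite sy.
Qed.

End Parity.

(** * Signs of Poisson counts *)

Lemma measurable_nat_comp (d : measure_display) (T : measurableType d) (K : realType)
    (N : T -> nat) (h : nat -> K) :
  (forall n, measurable [set w | N w = n]) -> measurable_fun setT (h \o N).
Proof.
move=> mN _ Y mY; rewrite setTI.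
rewrite (_ : _ @^-1` _ = \bigcup_(n in [set n | Y (h n)]) [set w | N w = n]).
  by apply: bigcup_measurable => n _; exact: mN.
by apply/seteqP; split => [w Yw|w [n /= Yn Nn]]; [exists (N w)|rewrite /= Nn].
Qed.

Lemma asbool_indic (K : realType) (T : Type) (V : T -> Prop) (w : T) :
  `[< V w >]%:R = \1_[set w | V w] w :> K.
Proof. by rewrite indicE; congr (nat_of_bool _)%:R; apply/asboolP/idP; rewrite inE. Qed.

Section Bounded.
Context {K : realType} {d : measure_display} {T : measurableType d}.
Context {P : probability T K}.

Lemma bounded_integrable (f : T -> K) (c : K) : measurable_fun setT f ->
  (forall w, `|f w| <= c) -> P.-integrable setT (EFin \o f).
Proof.
move=> mf fc; apply: measurable_bounded_integrable => //.
  by rewrite (le_lt_trans (probability_le1 P measurableT))// ltry.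
by exists c; split; [exact: num_real|move=> y cy w _; exact: le_trans (fc w) (ltW cy)].
Qed.

Lemma Rintegral_sum (n : nat) (f : 'I_n -> T -> K) :
  (forall i, P.-integrable setT (EFin \o f i)) ->
  \int[P]_w (\sum_(i < n) f i w) = \sum_(i < n) \int[P]_w f i w.
Proof.
move=> fi; rewrite /Rintegral.
under eq_integral do rewrite -sumEFin.
rewrite integral_sum//.
by rewrite -sum_fine// => i _; exact: integrable_fin_num (fi i).
Qed.

(* Chebyshev-type bound: pairwise almost uncorrelated variables of common mean [c]
   satisfy [0 <= E (\sum (W k - c))^2 <= n + n^2 (eps - c^2)]. *)
Lemma second_moment (W : nat -> T -> K) (c eps : K) (n : nat) :
  (forall k, measurable_fun setT (W k)) -> (forall k w, `|W k w| <= 1) ->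
  (forall k, \int[P]_w W k w = c) ->
  (forall j k, (j < k)%N -> \int[P]_w (W j w * W k w) <= eps) ->
  0 <= eps -> (0 < n)%N -> c ^+ 2 <= n%:R^-1 + eps.
Proof.
move=> mW W1 Wc Weps eps0 n0.
have W1' k w : -1 <= W k w <= 1 by rewrite -ler_norml.
have mWW j k : measurable_fun setT (fun w => W j w * W k w) by exact: measurable_funM.
have iW k : P.-integrable setT (EFin \o W k) by exact: (@bounded_integrable _ 1).
have iWW j k : P.-integrable setT (EFin \o (fun w => W j w * W k w)).
  by apply: (@bounded_integrable _ 1) => // w; rewrite normrM mulr_ile1.
have ma j k : measurable_fun setT (fun w => (W j w - c) * (W k w - c)).
  by apply: measurable_funM; apply: measurable_funB.
have ia j k : P.-integrable setT (EFin \o (fun w => (W j w - c) * (W k w - c))).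
  apply: (@bounded_integrable _ ((1 + `|c|) * (1 + `|c|))) => // w.
  by rewrite normrM ler_pM// (le_trans (ler_normB _ _)) ?lerD2r.
have Ia j k : \int[P]_w ((W j w - c) * (W k w - c)) = \int[P]_w (W j w * W k w) - c ^+ 2.
  transitivity (\int[P]_w (W j w * W k w + ((- c) * W j w + ((- c) * W k w + c ^+ 2)))).
    by apply: eq_Rintegral => w _; ring.
  have i1 k' : P.-integrable setT (EFin \o (fun w => (- c) * W k' w)).
    apply: (@bounded_integrable _ `|c|) => [|w].
      by apply: measurable_funM => //.
    by rewrite normrM normrN ler_piMr.
  have i2 : P.-integrable setT (EFin \o (fun=> c ^+ 2)).
    by apply: (@bounded_integrable _ `|c ^+ 2|).
  have i3 : P.-integrable setT (EFin \o (fun w => (- c) * W k w + c ^+ 2)).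
    have := integrableD measurableT (i1 k) i2; apply: eq_integrable => //.
  have i4 : P.-integrable setT (EFin \o (fun w => (- c) * W j w + ((- c) * W k w + c ^+ 2))).
    have := integrableD measurableT (i1 j) i3; apply: eq_integrable => //.
  rewrite RintegralD// RintegralD// RintegralD//.
  rewrite (RintegralZl (- c) measurableT (iW j)) (RintegralZl (- c) measurableT (iW k)).
  rewrite (Wc j) (Wc k) Rintegral_cst//.
  rewrite [fine _](congr1 fine (probability_setT P)) /=; ring.
(* On the diagonal the second moment is at most 1, which accounts for the extra term when
   [j = k]. *)
have le1 j k : \int[P]_w ((W j w - c) * (W k w - c)) <= (j == k)%:R + (eps - c ^+ 2).
  rewrite Ia; have [<-|jk] := eqVneq j k.
    suff : \int[P]_w (W j w * W j w) <= 1 by rewrite /= mulr1n; lra.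
    rewrite (le_trans (@le_Rintegral _ _ _ _ _ _ (fun=> 1) measurableT (iWW j j) _ _))//.
    - by apply: (@bounded_integrable _ 1) => // w; rewrite normr1.
    - by move=> w _; rewrite -expr2 -real_normK ?num_real// expr_le1.
    - by rewrite Rintegral_cst// [fine _](congr1 fine (probability_setT P)) mulr1.
  rewrite add0r lerD2r; have [lt|lt|E] := ltngtP j k; first exact: Weps.
    rewrite (_ : (fun w => _) = (fun w => W k w * W j w)); first exact: Weps.
    by apply/funext => w; rewrite mulrC.
  by rewrite E eqxx in jk.
(* The double sum is the square of the centred sum. *)
have pos : 0 <= \int[P]_w (\sum_(j < n) \sum_(k < n) ((W j w - c) * (W k w - c))).
  apply: Rintegral_ge0 => w _.
  rewrite (_ : \sum_(j < n) _ = (\sum_(j < n) (W j w - c)) ^+ 2) ?sqr_ge0//.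
  by rewrite expr2 big_distrlr.
have {pos} : 0 <= \sum_(j < n) \sum_(k < n) ((j == k :> nat)%:R + (eps - c ^+ 2)).
  apply: (le_trans pos).
  rewrite Rintegral_sum.
    apply: ler_sum => j _; rewrite Rintegral_sum; last by move=> k; exact: ia.
    by apply: ler_sum => k _; exact: le1.
  move=> j; have := integrable_sum measurableT (index_enum 'I_n) (P := xpredT)
    (h := fun k : 'I_n => EFin \o (fun w => (W j w - c) * (W k w - c))) (fun k _ => ia j k).
  by apply: eq_integrable => // w _ /=; rewrite sumEFin.
have E (j : 'I_n) : \sum_(k < n) ((j == k :> nat)%:R + (eps - c ^+ 2)) =
    1 + n%:R * (eps - c ^+ 2).
  rewrite big_split/= sumr_const card_ord mulr_natl; congr (_ + _).
  rewrite (bigD1 j)//= eqxx big1 ?addr0// => k kj.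
  by rewrite (_ : (j == k :> nat) = false)//; apply/negbTE; rewrite eq_sym.
under eq_bigr do rewrite E.
rewrite sumr_const card_ord -[X in 0 <= X -> _]mulr_natl.
have N0 : 0 < n%:R :> K by rewrite ltr0n.
rewrite pmulr_rge0// => h.
have : c ^+ 2 * n%:R <= (n%:R^-1 + eps) * n%:R by rewrite mulrDl mulVf ?gt_eqF//; lra.
by rewrite ler_pM2r.
Qed.
End Bounded.

(** * Void probabilities and signs for the Poisson process *)

Section Poisson.
Context {K : realType} {d : measure_display} {T : measurableType d}.
Context {P : probability T K} {R : T -> set K}.
Hypothesis hpoi : poisson_process1 P R.
Local Notation rT := (measurableTypeR K).
Implicit Types s t x : K.

Definition Ico s t : set rT := [set y | s <= y < t].

Lemma lebesgue_Ico s t : s <= t -> lebesgue_measure (Ico s t) = (t - s)%:E.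
Proof.
move=> st; rewrite (_ : Ico s t = [set` `[s, t[]); last first.
  by apply/seteqP; split => x /=; rewrite /Ico in_itv.
rewrite lebesgue_measure_itv /= lte_fin; move: st; rewrite le_eqVlt => /orP[/eqP ->|st].
  by rewrite ltxx subrr.
by rewrite st EFinB.
Qed.

Lemma measurable_points_eq (A : set rT) (n : nat) : measurable A ->
  measurable [set w | (R w `&` A #= `I_n)%card].
Proof. exact: hpoi.1.2. Qed.

Lemma void_card0 w t x : void_set (R w) t x <-> (R w `&` Ico t (t + x) #= `I_0)%card.
Proof. by rewrite II0 card_eq0; split => [/eqP|/eqP]. Qed.

Lemma measurable_void t x : measurable [set w | void_set (R w) t x].
Proof.
rewrite (_ : [set w | _] = [set w | (R w `&` Ico t (t + x) #= `I_0)%card]).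
  by apply: measurable_points_eq; exact: measurable_Ico.
by apply/seteqP; split => w /=; rewrite void_card0.
Qed.

Lemma npts_card w s t n : npts (R w) s t = n <-> (R w `&` Ico s t #= `I_n)%card.
Proof.
rewrite -(ecard_eqn (K := K)) ecard_npts; last exact: hpoi.1.1.
by split => [->//|[/eqP]]; rewrite eqr_nat => /eqP.
Qed.

Lemma measurable_npts s t n : measurable [set w | npts (R w) s t = n].
Proof.
rewrite (_ : [set w | _] = [set w | (R w `&` Ico s t #= `I_n)%card]).
  by apply: measurable_points_eq; exact: measurable_Ico.
by apply/seteqP; split => w /=; rewrite npts_card.
Qed.

Lemma prob_void t x : 0 <= x -> P [set w | void_set (R w) t x] = (expR (- x))%:E.
Proof.
move=> x0; have := hpoi.2 1%N (fun=> Ico t (t + x)) (fun=> 0%N) (fun=> measurable_Ico _ _).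
have tx : t <= t + x by rewrite lerDl.
rewrite big_ord1 (lebesgue_Ico tx) addrC addKr /= expr0 fact0 divr1 mulr1 => <-.
- congr (P _); apply/seteqP; split => w /=; first by move=> /void_card0 + _.
  by move=> /(_ ord0) /void_card0.
- by move=> _; rewrite ltry.
- by move=> i j _ _ _; rewrite (ord1 i) (ord1 j).
Qed.

(** The Poisson law is applied to three adjacent disjoint intervals with counts [0], [m], [0]. *)
Lemma prob_void_npts_void s t x m : 0 <= x -> s + x <= t ->
  P ([set w | void_set (R w) s x] `&` [set w | void_set (R w) t x] `&`
     [set w | npts (R w) (s + x) t = m]) =
  (expR (- x) * expR (- x) * (expR (- (t - s - x)) * (t - s - x) ^+ m / m`!%:R))%:E.
Proof.
move=> x0 sxt.
pose A (i : 'I_3) : set rT := nth set0 [:: Ico s (s + x); Ico (s + x) t; Ico t (t + x)] i.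
pose k (i : 'I_3) : nat := nth 0%N [:: 0; m; 0]%N i.
have sx : s <= s + x by rewrite lerDl.
have tx : t <= t + x by rewrite lerDl.
have mA i : measurable (A i).
  by case: i => [[|[|[|]]]] //= ?; exact: measurable_Ico.
have fA i : (lebesgue_measure (A i) < +oo)%E.
  by case: i => [[|[|[|]]]] //= ?; rewrite /A /= lebesgue_Ico// ltry.
have tA : trivIset setT A.
  move=> [[|[|[|]]]//= i3] [[|[|[|]]]//= j3] _ _; rewrite /A /= => -[y []];
    rewrite /Ico /= => h1 h2; try exact: val_inj; exfalso; set_interval_lra.
have := hpoi.2 3%N A k mA fA tA.
rewrite !big_ord_recl big_ord0 /A /k /= !lebesgue_Ico//= !expr0 !fact0 !divr1 !mulr1.
have -> : s + x - s = x by ring.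
have -> : t + x - t = x by ring.
have -> : t - (s + x) = t - s - x by ring.
move=> E; rewrite (_ : _ `&` _ = [set w | forall i, R w `&` A i #= `I_(k i)]%card).
  by rewrite E; congr (_%:E); ring.
apply/seteqP; split => w /=.
  move=> [[/void_card0 h0 /void_card0 h2] /npts_card h1].
  by case => [[|[|[|]]]].
move=> H; split; first split.
- by apply/void_card0; exact: (H (@Ordinal 3 0 isT)).
- by apply/void_card0; exact: (H (@Ordinal 3 2 isT)).
- by apply/npts_card; exact: (H (@Ordinal 3 1 isT)).
Qed.

(* The generating function of a Poisson count at [-1]. *)
Lemma void_sign_mean s t x : 0 <= x -> s + x <= t ->
  \int[P]_w (`[< void_set (R w) s x >]%:R * `[< void_set (R w) t x >]%:R *
             (-1) ^+ npts (R w) (s + x) t) =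
  expR (- x) * expR (- x) * (expR (- (t - s - x)) * expR (- (t - s - x))).
Proof.
move=> x0 sxt; set l := t - s - x.
set V := [set w | void_set (R w) s x] `&` [set w | void_set (R w) t x].
have mV : measurable V by apply: measurableI; exact: measurable_void.
pose Y w : K := \1_V w * (-1) ^+ npts (R w) (s + x) t.
rewrite /Rintegral (eq_integral (EFin \o Y)); last first.
  by move=> w _; rewrite !asbool_indic -[in RHS]/(Y w) /Y indicI.
have mY : measurable_fun setT Y.
  apply: measurable_funM; first exact: measurable_indic.
  exact: (measurable_nat_comp (fun m => (-1) ^+ m) (measurable_npts _ _)).
have iY : P.-integrable setT (EFin \o Y).
  apply: (@bounded_integrable _ _ _ _ _ 1) => // w.
  by rewrite /Y normrM normrX normrN1 expr1n mulr1 indicE;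
    case: (_ \in _); rewrite ?normr1 ?normr0.
(* The integral is split according to the number [m] of points between the two gaps. *)
pose F m := [set w | npts (R w) (s + x) t = m].
have mF m : measurable (F m) by exact: measurable_npts.
have UF : \bigcup_m F m = setT by apply/seteqP; split => // w _; exists (npts (R w) (s + x) t).
have tF : trivIset setT F by move=> i j _ _ [w [<- <-]].
rewrite -UF integral_bigcup//; last by rewrite UF.
(* The sign [(-1)^m] is absorbed into [l^m], which leaves the exponential series at [- l]. *)
pose a m : K := expR (- x) * expR (- x) * expR (- l) * ((- l) ^+ m / m`!%:R).
rewrite (_ : (fun n => _) = EFin \o series a); last first.
  apply/funext => n /=; rewrite -sumEFin; apply: eq_bigr => m _.
  rewrite (eq_integral (fun w => ((-1) ^+ m)%:E * (\1_V w)%:E)%E); last first.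
    by move=> w; rewrite inE => Fw; rewrite /= /Y (Fw : npts _ _ _ = m) mulrC EFinM.
  rewrite integralZl//; last first.
    apply: (integrableS measurableT) => //.
    apply: (@bounded_integrable _ _ _ _ _ 1); first exact: measurable_indic.
    by move=> w; rewrite indicE; case: (_ \in _); rewrite ?normr1 ?normr0.
  rewrite integral_indic//.
  transitivity (((-1) ^+ m)%:E *
      (expR (- x) * expR (- x) * (expR (- l) * l ^+ m / m`!%:R))%:E)%E.
    by congr (_ * _)%E; exact: prob_void_npts_void.
  rewrite -EFinM; congr (_%:E).
  by rewrite /a (exprNn l); ring.
have E : series a =
    (fun n => expR (- x) * expR (- x) * expR (- l) * series (exp_coeff (- l)) n).
  by apply/funext => n; rewrite /series /= big_distrr.
have cE : cvgn (series (exp_coeff (- l))) by exact: is_cvg_series_exp_coeff.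
have cv : series a @ \oo --> expR (- x) * expR (- x) * expR (- l) * expR (- l).
  by rewrite E; apply: cvgMr => //; exact: cE.
rewrite EFin_lim; last by apply/cvg_ex; eexists; exact: cv.
by rewrite (cvg_lim _ cv)//= mulrA.
Qed.

End Poisson.

(** * Spanning edges *)

Section Spanning.
Context {K : realType} {d : measure_display} {T : measurableType d}.
Context {P : probability T K} {R : T -> set K} {M : T -> set (K * K)}.
Hypothesis hpoi : poisson_process1 P R.
Hypothesis hms : matching_scheme R M.
Hypothesis hinv : invariant_scheme P R M.
Hypothesis hc : \forall w \ae P, consecutive_matching (R w) (M w).
Local Notation rT := (measurableTypeR K).
Local Notation KK := (rT * rT)%type.
Local Notation mean := (mean_edges P R M).

Lemma measurable_spanning (s t : K) : measurable (spanning s t : set KK).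
Proof.
rewrite (_ : spanning s t =
  [set e : KK | [set` `]-oo, s[] e.1] `&`
  [set e : KK | [set` `[t, +oo[] e.2]).
  apply: measurableI.
    exact: (measurable_preimage_fst (@measurable_itv K `]-oo, s[)).
  exact: (measurable_preimage_snd (@measurable_itv K `[t, +oo[)).
by apply/seteqP; split => e; rewrite /spanning /= !in_itv /= andbT.
Qed.

Lemma mean_spanning_shift (s t : K) : mean (spanning s t) = mean (spanning 0 (t - s)).
Proof.
have E : [set e : KK | spanning s t (e.1 + s, e.2 + s)] = spanning 0 (t - s).
  by apply/seteqP; split => e; rewrite /spanning /= => h; set_interval_lra.
by rewrite (mean_edges_translate hms hinv (t := s)) ?E//; exact: measurable_spanning.
Qed.

Let U t x := [set w | M w `&` spanning t (t + x) !=set0].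
Let V t x := [set w | void_set (R w) t x].

Lemma measurable_spanned t x : measurable (U t x).
Proof.
rewrite (_ : U t x = ~` (pair_config R M @^-1`
    [set c : config K | (c.2 `&` spanning t (t + x) #= `I_0)%card])).
  apply: measurableC; rewrite -[X in measurable X]setTI; apply: hms.2 => //.
  apply: sub_sigma_algebra; right; exists (spanning t (t + x)); last by exists 0%N.
  exact: measurable_spanning.
apply/seteqP; split => w /=; rewrite II0 card_eq0.
  by move=> /set0P/negP.
by move=> /negP/set0P.
Qed.

(** Almost surely at most one edge spans the gap, and it leaves the gap void, so the count is the
    indicator of the event. *)
Lemma mean_spanningE t x : 0 <= x -> P (V t x `&` U t x) = mean (spanning t (t + x)).
Proof.
move=> x0; have mV : measurable (V t x) := measurable_void hpoi t x.
have mVU := measurableI _ _ mV (measurable_spanned t x).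
rewrite -[X in P X]setIT -integral_indic// /mean_edges; apply: ge0_ae_eq_integral => //.
- by apply/measurable_EFinP; exact: measurable_indic.
- exact: (measurable_edges_scheme hms (measurable_spanning _ _)).
- by move=> w _; exact: edges_in_ge0.
apply: filterS hc => w cM _; rewrite /edges_in indicE.
have [[[vw [e Me]]]|nU] := pselect ((V t x `&` U t x) w).
  rewrite mem_set/=; last by split => //; exists e.
  rewrite -(ecard1 (K := K) e); congr ecard; apply/seteqP; split => [_ ->//|f Mf].
  by apply: (crossing_unique (t := t) cM); [case: Mf|case: Me] => ? [h1 h2]; split => //;
    rewrite /crossing /= h1 (le_trans _ h2)// lerDl.
rewrite memNset//= (_ : M w `&` _ = set0) ?ecard0//.
apply/seteqP; split => // e Me; apply: nU; have Ue : U t x w by exists e.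
by split => //; have [] := (spanning_crossing t cM x0).1 Ue.
Qed.

Lemma measurable_gap_sign t x : measurable_fun setT (fun w => gap_sign (R w) (M w) t x).
Proof.
rewrite (_ : (fun w => _) = fun w => \1_(V t x) w * (1 - 2 * \1_(U t x) w)).
  apply: measurable_funM; first exact: (measurable_indic (measurable_void hpoi t x)).
  apply: measurable_funB => //; apply: measurable_funM => //.
  exact: (measurable_indic (measurable_spanned t x)).
by apply/funext => w; rewrite /gap_sign !asbool_indic.
Qed.

Lemma gap_sign_le1 t x w : `|gap_sign (R w) (M w) t x| <= 1.
Proof.
rewrite /gap_sign; case: `[< _ >]; case: `[< _ >]; rewrite /= ?mul0r ?normr0//.
  by rewrite ler_norml; lra.
by rewrite ler_norml; lra.
Qed.

(** The sign is [1] minus twice the indicator of a spanning edge, on the void event of probability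
    [e^(-x)]. *)
Lemma mean_gap_sign t x : 0 <= x ->
  \int[P]_w gap_sign (R w) (M w) t x = expR (- x) - 2 * fine (mean (spanning 0 x)).
Proof.
move=> x0; have mV : measurable (V t x) := measurable_void hpoi t x.
have mVU := measurableI _ _ mV (measurable_spanned t x).
have bi (A : set T) : measurable A -> P.-integrable setT (EFin \o (\1_A : T -> K)).
  move=> mA; apply: (@bounded_integrable _ _ _ _ _ 1); first exact: measurable_indic.
  by move=> w; rewrite indicE; case: (_ \in _); rewrite ?normr1 ?normr0.
transitivity (\int[P]_w (\1_(V t x) w - 2 * \1_(V t x `&` U t x) w)).
  apply: eq_Rintegral => w _; rewrite /gap_sign !asbool_indic -/(V t x) -/(U t x).
  by rewrite indicI /=; ring.
have i2 : P.-integrable setT (EFin \o (fun w => 2 * \1_(V t x `&` U t x) w)).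
  by have := integrableZl measurableT 2 (bi _ mVU); apply: eq_integrable.
rewrite RintegralB//; last exact: bi.
rewrite (RintegralZl _ measurableT (bi _ mVU)) /Rintegral !integral_indic// !setIT.
congr (_ - 2 * fine _); first exact: (congr1 fine (prob_void hpoi t x0)).
apply: etrans (mean_spanningE t x0) _.
by rewrite mean_spanning_shift addrC addKr.
Qed.

(** The exact value is [e^(-2x) e^(-2l)] with [l = t - s - x]; a single factor [e^(-l)] is kept as
    bound. *)
Lemma mean_gap_sign_mul s t x : 0 <= x -> s + x <= t ->
  \int[P]_w (gap_sign (R w) (M w) s x * gap_sign (R w) (M w) t x) <= expR (- (t - s - x)).
Proof.
move=> x0 sxt.
have -> : \int[P]_w (gap_sign (R w) (M w) s x * gap_sign (R w) (M w) t x) =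
  \int[P]_w (`[< void_set (R w) s x >]%:R * `[< void_set (R w) t x >]%:R *
             (-1) ^+ npts (R w) (s + x) t).
  rewrite /Rintegral; congr fine; apply: ae_eq_integral => //.
  - by apply/measurable_EFinP; apply: measurable_funM; exact: measurable_gap_sign.
  - apply/measurable_EFinP; apply: measurable_funM.
      rewrite (_ : (fun w => _) = fun w => \1_(V s x) w * \1_(V t x) w).
        apply: measurable_funM; apply: measurable_indic; exact: (measurable_void hpoi).
      by apply/funext => w; rewrite !asbool_indic.
    exact: (measurable_nat_comp (fun m => (-1) ^+ m) (measurable_npts hpoi _ _)).
  - by apply: filterS hc => w cM _; rewrite gap_sign_mul.
rewrite (void_sign_mean hpoi)//.
have l0 : 0 <= t - s - x by lra.
have ex : expR (- x) <= 1 by rewrite -expR0 ler_expR oppr_le0.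
have el : expR (- (t - s - x)) <= 1 by rewrite -expR0 ler_expR oppr_le0.
have ex0 := expR_ge0 (- x); have el0 := expR_ge0 (- (t - s - x)).
have exx : expR (- x) * expR (- x) <= 1 by rewrite mulr_ile1.
have ell : expR (- (t - s - x)) * expR (- (t - s - x)) <= expR (- (t - s - x)).
  by rewrite ler_piMr.
by rewrite (le_trans _ ell)// ler_piMl// mulr_ge0.
Qed.

(* The sign of the alternating matching at [t] decorrelates from its sign at [0],
   hence covers [0] with probability 1/2 independently of the gap around [0]. *)
Lemma mean_spanning (x : K) : 0 <= x -> mean (spanning 0 x) = (expR (- x) / 2)%:E.
Proof.
move=> x0; have fin : mean (spanning 0 x) \is a fin_num.
  have -> : spanning 0 x = spanning 0 (0 + x) by rewrite add0r.
  rewrite -(mean_spanningE 0 x0); apply: fin_num_measure.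
  by apply: measurableI; [exact: (measurable_void hpoi)|exact: measurable_spanned].
rewrite -(fineK fin); congr (_%:E); set m := fine _.
(* The common mean of all gap signs, which has to vanish. *)
pose c := expR (- x) - 2 * m.
suff : c = 0 by clear fin; rewrite /c; lra.
have key (n : nat) : (0 < n)%N -> c ^+ 2 <= 2 / n%:R.
  (* Gaps placed at multiples of [L] are separated by at least [n], so their correlations are at
     most [e^(-n) <= 1 / n]. *)
  move=> n0; pose L := ((Num.truncn x).+1 + n)%N.
  have xL : x + n%:R <= L%:R by rewrite natrD lerD2r ltW// truncnS_gt.
  have N0 : 0 < n%:R :> K by rewrite ltr0n.
  have i0 : 0 <= n%:R^-1 :> K by rewrite invr_ge0 ltW.
  rewrite (_ : 2 / n%:R = n%:R^-1 + n%:R^-1); last by rewrite mulrDl mul1r.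
  apply: (@second_moment _ _ _ P (fun k w => gap_sign (R w) (M w) (k%:R * L%:R) x)) => //.
  - by move=> k; exact: measurable_gap_sign.
  - by move=> k w; exact: gap_sign_le1.
  - by move=> k; exact: mean_gap_sign.
  move=> j k jk; have h : j%:R * L%:R + L%:R <= k%:R * L%:R :> K.
    by rewrite -!natrM -natrD ler_nat -mulSnr leq_mul2r jk orbT.
  apply: (le_trans (mean_gap_sign_mul x0 _)); first lra.
  set l := (_ - _ - x); have ln : n%:R <= l by rewrite /l; lra.
  rewrite expRN lef_pV2 ?posrE ?expR_gt0//.
  by rewrite (le_trans ln)// (le_trans _ (expR_ge1Dx l))// lerDr.
apply/eqP; rewrite -sqrf_eq0; apply/negPn/negP => c0.
have cp : 0 < c ^+ 2 by rewrite lt_def c0 sqr_ge0.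
have := key (Num.truncn (2 / c ^+ 2)).+1 isT.
rewrite ler_pdivlMr ?ltr0n// mulrC -ler_pdivlMr// leNgt => /negP; apply.
exact: truncnS_gt.
Qed.

(** These edges are those over [[t, v)] that are not over [[s, v)]. *)
Lemma mean_spanning_strip (s t v : K) : s <= t -> t <= v ->
  mean [set e | s <= e.1 < t /\ v <= e.2] =
  ((expR (- (v - t)) - expR (- (v - s))) / 2)%:E.
Proof.
move=> st tv.
have := @mean_edgesID _ _ _ P _ _ hms (spanning s v) (spanning t v)
  (measurable_spanning _ _) (measurable_spanning _ _).
rewrite (_ : _ `&` spanning s v = spanning s v); last first.
  by apply/seteqP; split => e; rewrite /spanning /= => h; set_interval_lra.
rewrite (_ : _ `&` ~` spanning s v = [set e | s <= e.1 < t /\ v <= e.2]); last first.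
  apply/seteqP; split => e; rewrite /spanning /=.
    move=> [[et ve] n]; rewrite et ve andbT leNgt; split => //.
    by apply/negP => es; apply: n.
  by move=> [/andP[se et] ve]; split => // -[]; rewrite ltNge se.
rewrite (mean_spanning_shift t) (mean_spanning_shift s) !mean_spanning ?subr_ge0//; last first.
  exact: le_trans st tv.
set A := mean _; have := mean_edges_ge0 P R M [set e | s <= e.1 < t /\ v <= e.2].
rewrite -/A; case: A => [a| |]// _; rewrite -EFinD => -[E]; congr (_%:E); lra.
Qed.

(** These edges are those over [[u, s)] that are not over [[u, t)]. *)
Lemma mean_spanning_strip_right (s t u : K) : u <= s -> s <= t ->
  mean [set e | s <= e.2 < t /\ e.1 < u] =
  ((expR (- (s - u)) - expR (- (t - u))) / 2)%:E.
Proof.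
move=> us st.
have := @mean_edgesID _ _ _ P _ _ hms (spanning u t) (spanning u s)
  (measurable_spanning _ _) (measurable_spanning _ _).
rewrite (_ : _ `&` spanning u t = spanning u t); last first.
  by apply/seteqP; split => e; rewrite /spanning /= => h; set_interval_lra.
rewrite (_ : _ `&` ~` spanning u t = [set e | s <= e.2 < t /\ e.1 < u]); last first.
  apply/seteqP; split => e; rewrite /spanning /=.
    move=> [[eu se] n]; rewrite se eu ltNge; split => //.
    by apply/negP => te; apply: n.
  by move=> [/andP[se et] eu]; split => // -[_]; rewrite leNgt et.
rewrite !(mean_spanning_shift u) !mean_spanning ?subr_ge0//; last first.
  exact: le_trans us st.
set A := mean _; have := mean_edges_ge0 P R M [set e | s <= e.2 < t /\ e.1 < u].
rewrite -/A; case: A => [a| |]// _; rewrite -EFinD => -[E]; congr (_%:E); lra.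
Qed.
End Spanning.

(** * The matching distance *)

Section Exponential.
Context {K : realType} {d : measure_display} {T : measurableType d}.
Context {P : probability T K} {R : T -> set K} {M : T -> set (K * K)}.
Context {d' : measure_display} {T' : measurableType d'}.
Context {P' : probability T' K} {R' : T' -> set K} {M' : T' -> set (K * K)}.
Hypothesis hpoi : poisson_process1 P R.
Hypothesis hms : matching_scheme R M.
Hypothesis hinv : invariant_scheme P R M.
Hypothesis hc : \forall w \ae P, consecutive_matching (R w) (M w).
Hypothesis hpalm : palm_process P R M P' R' M'.
Local Notation rT := (measurableTypeR K).
Local Notation KK := (rT * rT)%type.
Local Notation mean := (mean_edges P R M).

Lemma measurable_left_strip (s t v : K) :
  measurable ([set e | s <= e.1 < t /\ v <= e.2] : set KK).
Proof.
rewrite (_ : [set e | _] =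
  [set e : KK | [set` `[s, t[] e.1] `&`
  [set e : KK | [set` `[v, +oo[] e.2]).
  apply: measurableI.
    exact: (measurable_preimage_fst (@measurable_itv K `[s, t[)).
  exact: (measurable_preimage_snd (@measurable_itv K `[v, +oo[)).
by apply/seteqP; split => e; rewrite /= !in_itv /= andbT.
Qed.

Lemma measurable_right_strip (s t u : K) :
  measurable ([set e | s <= e.2 < t /\ e.1 < u] : set KK).
Proof.
rewrite (_ : [set e | _] =
  [set e : KK | [set` `[s, t[] e.2] `&`
  [set e : KK | [set` `]-oo, u[] e.1]).
  apply: measurableI.
    exact: (measurable_preimage_snd (@measurable_itv K `[s, t[)).
  exact: (measurable_preimage_fst (@measurable_itv K `]-oo, u[)).
by apply/seteqP; split => e; rewrite /= !in_itv.
Qed.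

(** For a left end in [[0, h)], a right end at or beyond [h + x] forces length above [x], which in
    turn forces a right end beyond [x]. *)
Lemma mean_left_in_bounds (x h : K) : 0 <= h -> h <= x ->
  (((expR (- x) - expR (- (h + x))) / 2)%:E <= mean (left_in 0 h [set l | (x < l)%R]) <=
   ((expR (- (x - h)) - expR (- x)) / 2)%:E)%E.
Proof.
move=> h0 hx; have mL := measurable_left_in 0 h (measurable_Ioy x); apply/andP; split.
  have hhx : h <= h + x by lra.
  have := mean_spanning_strip hpoi hms hinv hc h0 hhx.
  rewrite subr0 [h + x - h]addrC addKr => <-.
  apply: (le_mean_edges P hms (measurable_left_strip _ _ _) mL).
  by move=> e; rewrite /left_in /= => H; set_interval_lra.
have := mean_spanning_strip hpoi hms hinv hc h0 hx.
rewrite subr0 => <-.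
apply: (le_mean_edges P hms mL (measurable_left_strip _ _ _)).
by move=> e; rewrite /left_in /= => H; set_interval_lra.
Qed.

(** For a right end in [[0, h)], a left end below [- x] forces length above [x], which in turn
    forces a left end below [h - x]. *)
Lemma mean_right_in_bounds (x h : K) : 0 <= h -> h <= x ->
  (((expR (- x) - expR (- (h + x))) / 2)%:E <= mean (right_in 0 h [set l | (x < l)%R]) <=
   ((expR (- (x - h)) - expR (- x)) / 2)%:E)%E.
Proof.
move=> h0 hx; have mL := measurable_right_in 0 h (measurable_Ioy x); apply/andP; split.
  have nx : - x <= 0 by lra.
  have := mean_spanning_strip_right hpoi hms hinv hc nx h0.
  rewrite sub0r !opprK => <-.
  apply: (le_mean_edges P hms (measurable_right_strip _ _ _) mL).
  by move=> e; rewrite /right_in /= => H; set_interval_lra.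
have nx : h - x <= 0 by lra.
have := mean_spanning_strip_right hpoi hms hinv hc nx h0.
rewrite subKr sub0r opprB => <-.
apply: (le_mean_edges P hms mL (measurable_right_strip _ _ _)).
by move=> e; rewrite /right_in /= => H; set_interval_lra.
Qed.

(** The unit window is cut into [n] windows of length [1 / n]; left and right ends contribute one
    half each, which gives difference quotients of [e^(-x)]. *)
Lemma root_edge_bounds (x : K) (n : nat) : (0 < n)%N -> n%:R^-1 <= x ->
  ((n%:R * (expR (- x) - expR (- (n%:R^-1 + x))))%:E <=
   P' (root_edge (M' := M') [set l | (x < l)%R]) <=
   (n%:R * (expR (- (x - n%:R^-1)) - expR (- x)))%:E)%E.
Proof.
move=> n0 nx; have N0 : 0 < n%:R :> K by rewrite ltr0n.
have h0 : 0 <= n%:R^-1 :> K by rewrite invr_ge0 ltW.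
have mJ := measurable_Ioy x.
have one : 1 = n%:R^-1 *+ n :> K by rewrite -[RHS]mulr_natr mulVf ?gt_eqF.
have E1 := left_in_multiple hms hinv n h0 mJ; have E2 := right_in_multiple hms hinv n h0 mJ.
rewrite (palm_root_edge hms hpalm)//; rewrite -one in E1 E2; rewrite E1 E2.
have /andP[l1 l2] := mean_left_in_bounds h0 nx.
have /andP[r1 r2] := mean_right_in_bounds h0 nx.
move: l1 l2 r1 r2 (mean_edges_ge0 P R M (left_in 0 n%:R^-1 [set l | x < l]))
  (mean_edges_ge0 P R M (right_in 0 n%:R^-1 [set l | x < l])).
case: (mean (left_in _ _ _)) => [a| |]//; case: (mean (right_in _ _ _)) => [b| |]//.
rewrite -!EFinM -EFinD !lee_fin -mulrDr => l1 l2 r1 r2 _ _.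
rewrite !ler_pM2l//; lra.
Qed.

Lemma root_edge_exp (x : K) : 0 < x ->
  P' (root_edge (M' := M') [set l | (x < l)%R]) = (expR (- x))%:E.
Proof.
move=> x0.
have mE := measurable_root_edge hpalm (measurable_Ioy x).
have fin : P' (root_edge (M' := M') [set l | (x < l)%R]) \is a fin_num.
  exact: (fin_num_measure P' _ mE).
have p1 : fine (P' (root_edge (M' := M') [set l | (x < l)%R])) <= 1.
  by rewrite -lee_fin fineK// probability_le1.
have p0 : 0 <= fine (P' (root_edge (M' := M') [set l | (x < l)%R])) by apply: fine_ge0.
have key n (n0 : (0 < n)%N) (nx : n%:R^-1 <= x) := root_edge_bounds n0 nx.
move: p0 p1 key; rewrite -(fineK fin); set p := fine _ => p0 p1 key; congr (_%:E).
(* The derivative is taken quantitatively: the quotients trap [p] within [1 / n] of [e^(-x)]. *)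
have close (n : nat) : (0 < n)%N -> n%:R^-1 <= x -> `|p - expR (- x)| <= n%:R^-1.
  move=> n0 nx; have := key n n0 nx; rewrite !lee_fin.
  have N0 : 0 < n%:R :> K by rewrite ltr0n.
  have hn : n%:R * n%:R^-1 = 1 :> K by rewrite mulfV ?gt_eqF.
  have h0 : 0 < n%:R^-1 :> K by rewrite invr_gt0.
  set N : K := n%:R in N0 hn h0 *; set h := N^-1 in hn h0 nx *.
  rewrite opprB opprD !expRD; set E := expR (- x).
  have E0 : 0 < E := expR_gt0 _.
  have e1 := expR_ge1Dx h; have e2 := expR_ge1Dx (- h); have e3 := expRxMexpNx_1 h.
  have a0 := expR_gt0 h; have b0 := expR_gt0 (- h).
  move: e1 e2 e3 a0 b0; set a := expR h; set b := expR (- h) => e1 e2 e3 a0 b0.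
  move=> /andP[lo hi].
  (* From [1 + h <= e^h] one gets [e^(-h) (1 + h) <= 1], so the lower quotient times [1 + h] is at
     least [E]. *)
  have lo' : E <= p * (1 + h).
    have B : (1 - b) * (1 + h) >= h by nra.
    have h1 : 0 <= 1 + h by lra.
    apply: le_trans (ler_wpM2r h1 lo).
    rewrite (_ : N * (E - b * E) * (1 + h) = E * (N * ((1 - b) * (1 + h)))); last by ring.
    by rewrite ler_peMr ?(ltW E0)// -[X in X <= _]hn ler_pM2l.
  (* Likewise [e^h (1 - h) <= 1]; for [h > 1] the left side is nonpositive. *)
  have hi' : p * (1 - h) <= E.
    have B : (a - 1) * (1 - h) <= h by nra.
    have [h1|h1] := leP h 1; last first.
      apply: (@le_trans _ _ 0); last exact: ltW.
      by apply: mulr_ge0_le0 => //; rewrite subr_le0 ltW.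
    have h1' : 0 <= 1 - h by lra.
    apply: le_trans (ler_wpM2r h1' hi) _.
    rewrite (_ : N * (a * E - E) * (1 - h) = E * (N * ((a - 1) * (1 - h)))); last by ring.
    by rewrite ler_piMr ?(ltW E0)// -[X in _ <= X]hn ler_pM2l.
  by rewrite ler_norml; apply/andP; split; nra.
apply/eqP; rewrite -subr_eq0 -normr_eq0; apply/negPn/negP => ne.
have e0 : 0 < `|p - expR (- x)| by rewrite lt_def ne normr_ge0.
(* Taking [1 / n <= m] bounds the nonzero distance by half of itself. *)
pose m := Num.min x (`|p - expR (- x)| / 2).
have m0 : 0 < m by rewrite lt_min x0 divr_gt0.
have nm : (Num.truncn m^-1).+1%:R^-1 <= m.
  by rewrite invf_ple ?posrE ?ltr0n// ltW// truncnS_gt.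
have mx : m <= x by rewrite ge_min lexx.
have me : m <= `|p - expR (- x)| / 2 by rewrite ge_min lexx orbT.
have := le_trans (close _ (ltn0Sn _) (le_trans nm mx)) (le_trans nm me).
by rewrite ler_pdivlMr// ger_pMr// leNgt ltr1n.
Qed.

End Exponential.

(** * Tail of the matching distance in the two ranges of parameters *)

Lemma minimal_consecutive (K : realType) (g : parameter K) (R : set K) (M : set (K * K)) :
  at_least_one g -> locally_finite R -> unmatched R M = set0 -> minimal g R M ->
  consecutive_matching R M.
Proof.
move=> g1 lf u0 mM; split => //; first exact: mM.1.
by move=> e x Me Rx; exact: (no_point_between g1 mM u0 Me Rx).
Qed.

Theorem theorem6 (K : realType) :
  (forall g : parameter K, at_least_one g ->
    forall (d : measure_display) (T : measurableType d) (P : probability T K)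
      (R : T -> set K) (M : T -> set (K * K)),
      poisson_process1 P R -> invariant_minimal_scheme P g R M ->
    forall (d' : measure_display) (T' : measurableType d')
      (P' : probability T' K) (R' : T' -> set K) (M' : T' -> set (K * K)),
      palm_process P R M P' R' M' ->
    forall x : K, 0 < x ->
      P' [set w | (x%:E < matching_distance M' w)%E] = (expR (- x))%:E)
  /\
  (forall g : \bar K, (g < 1%:E)%E ->
    exists c : K, 0 < c /\
    forall (d : measure_display) (T : measurableType d) (P : probability T K)
      (R : T -> set K) (M : T -> set (K * K)),
      poisson_process1 P R -> invariant_minimal_scheme P (Extended g) R M ->
    forall (d' : measure_display) (T' : measurableType d')
      (P' : probability T' K) (R' : T' -> set K) (M' : T' -> set (K * K)),
      palm_process P R M P' R' M' ->
    forall x : K, 0 < x ->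
      (P' [set w | (x%:E < matching_distance M' w)%E] < (c * x^-1)%:E)%E).
Proof.
split.
  move=> g g1 d T P R M hpoi [hms hinv hmin] d' T' P' R' M' hpalm x x0.
  have lf := hpoi.1.1.
  rewrite (matching_distance_tail hms hinv hmin hpalm x0).
  apply: (root_edge_exp hpoi hms hinv _ hpalm x0).
  apply: filterS2 hmin (perfect lf hms hinv hmin hpalm) => w mw u0.
  exact: (minimal_consecutive g1).
(* For [x >= 1] the bound [16 / x] is made strict by 17; for [x < 1] the probability is at most 1,
   below [17 / x]. *)
move=> g _; exists 17; split => // d T P R M hpoi [hms hinv hmin] d' T' P' R' M' hpalm x x0.
rewrite (matching_distance_tail hms hinv hmin hpalm x0).
have [x1|x1] := ltP x 1.
  apply: (@le_lt_trans _ _ 1%E).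
    by apply: probability_le1; exact: (measurable_root_edge hpalm (measurable_Ioy x)).
  by rewrite lte_fin ltr_pdivlMr// mul1r (lt_trans x1)// ltr1n.
apply: (le_lt_trans (tail_bound hms hinv hmin hpalm x1)).
by rewrite lte_fin ltr_pM2r ?invr_gt0// ltr_nat.
Qed.
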